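(* Suppose that $\mathcal{C}$ is the complex, regular spread of $\mathrm{PG}(3,\mathbb{R})$ and that $\Omega\le\mathrm{AGL}_3\mathbb{R}$, $\Omega\cong\mathrm{SO}_3\mathbb{R}$, is $\mathrm{O}_2\mathbb{R}$-admissible for $\mathcal{C}$. Then $\Omega(\mathcal{C})=\{\omega(\mathcal{C})\mid\omega\in\Omega\}$ is (up to isomorphism) the Clifford parallelism.
   Context: Lines of $\mathrm{PG}(3,\mathbb{R})$ are the 2-dimensional subspaces of $\mathbb{R}^4$. A compact spread is a compact set of pairwise disjoint lines covering the point set of $\mathrm{PG}(3,\mathbb{R})$ (the line space being a coset space of $\mathrm{PGL}(4,\mathbb{R})$). The complex (regular) spread is, up to collineations of $\mathrm{PG}(3,\mathbb{R})$, the set of 1-dimensional complex subspaces of $\mathbb{C}^2=\mathbb{R}^4$. View $\mathbb{R}^3$ as the affine complement of a plane of $\mathrm{PG}(3,\mathbb{R})$; $\mathrm{AGL}_3\mathbb{R}\le\mathrm{PGL}_4\mathbb{R}$ is the group of affine transformations of $\mathbb{R}^3$. A group $\Omega\le\mathrm{AGL}_3\mathbb{R}$ with $\Omega\cong\mathrm{SO}_3\mathbb{R}$ is $\mathrm{O}_2\mathbb{R}$-admissible for $\mathcal{C}$ if $\Omega$ contains a subgroup isomorphic to $\mathrm{O}_2\mathbb{R}$ under which $\mathcal{C}$ is invariant. Isomorphisms of groups are isomorphisms of topological groups. Clifford parallelism: identify $\mathbb{R}^4$ with the quaternions $\mathbb{H}$; the Clifford parallelism is the set of orbits, on the set of lines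 of $\mathrm{PG}(3,\mathbb{R})$, of the group $\{q\mapsto aq \mid a\in\mathbb{H},\ |a|=1\}$. Two parallelisms (sets of spreads) are isomorphic if a collineation of $\mathrm{PG}(3,\mathbb{R})$ maps one onto the other. *)

(* Defs.v *)
From HB Require Import structures.
From mathcomp Require Import all_boot all_order all_algebra.
From mathcomp Require Import complex.
From mathcomp Require Import all_classical all_reals all_analysis.
From mathcomp Require Import ring.

Set Implicit Arguments.
Unset Strict Implicit.
Unset Printing Implicit Defensive.

Import Order.TTheory GRing.Theory Num.Theory.
Import numFieldNormedType.Exports.

Local Open Scope classical_set_scope.
Local Open Scope ring_scope.

(* PG(3,R) is the geometry of the linear subspaces of the space 'cV[R]_4 of
   column vectors; square matrices act on it from the left. *)

Notation pg_subspace R := {vspace 'cV[R]_4}.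

Definition coord4 (R : realType) (x : 'cV[R]_4) (k : nat) : R := x (inord k) 0.

Definition pg_points (R : realType) : set (pg_subspace R) :=
  [set P | \dim P = 1%N].

Definition pg_lines (R : realType) : set (pg_subspace R) :=
  [set L | \dim L = 2%N].

(* A collineation permutes the points and the lines and preserves incidence;
   its values on the other subspaces are irrelevant. *)
Definition collineation (R : realType) (f : pg_subspace R -> pg_subspace R) :
    Prop :=
  [/\ set_bij (@pg_points R) (@pg_points R) f,
      set_bij (@pg_lines R) (@pg_lines R) f
    & forall P L, pg_points P -> pg_lines L -> (f P <= f L)%VS = (P <= L)%VS].

Definition parallelism_iso (R : realType)
    (P Q : set (set (pg_subspace R))) : Prop :=
  exists2 f : pg_subspace R -> pg_subspace R,
    collineation f & [set f @` S | S in P] = Q.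

(* R^4 = C^2 via (x0, x1, x2, x3) |-> (x0 + i x1, x2 + i x3). *)
Definition complex_coords (R : realType) (v : 'cV[R]_4) : 'cV[R[i]]_2 :=
  \col_(k < 2) (coord4 v k.*2 +i* coord4 v k.*2.+1)%C.

Definition complex_lines (R : realType) : set (pg_subspace R) :=
  [set L : pg_subspace R | exists2 W : {vspace 'cV[R[i]]_2},
      \dim W = 1%N & forall v : 'cV[R]_4, (v \in L) = (complex_coords v \in W)].

Definition complex_spread (R : realType) (C : set (pg_subspace R)) : Prop :=
  exists2 f : pg_subspace R -> pg_subspace R,
    collineation f & C = f @` @complex_lines R.

(* Matrix groups carry the subspace topology of the space of matrices. *)
Definition mx_group (R : realType) (n : nat) (G : set 'M[R]_n) : Prop :=
  [/\ G 1%:M,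
      forall A, G A -> A \in unitmx,
      forall A B, G A -> G B -> G (A *m B)
    & forall A, G A -> G (invmx A)].

Definition top_group_iso (R : realType) (m n : nat)
    (G : set 'M[R]_m) (H : set 'M[R]_n) : Prop :=
  exists (f : 'M[R]_m -> 'M[R]_n) (g : 'M[R]_n -> 'M[R]_m),
    [/\ set_bij G H f,
        forall A, G A -> g (f A) = A,
        forall A B, G A -> G B -> f (A *m B) = f A *m f B,
        {within G, continuous f}
      & {within H, continuous g}].

Definition orthogonal_group (R : realType) (n : nat) : set 'M[R]_n :=
  [set A | A *m A^T = 1%:M].

Definition special_orthogonal_group (R : realType) (n : nat) : set 'M[R]_n :=
  [set A | A *m A^T = 1%:M /\ \det A = 1].

(* The affine point x of R^3 is the point of PG(3,R) spanned by (1, x), and the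
   affine map x |-> A x + b is represented by the matrix with blocks 1, 0, b, A.
   As every element of PGL(4,R) that fixes the plane x0 = 0 has exactly one
   representative of this shape, AGL(3,R) is a group of matrices rather than of
   classes of matrices modulo scalars. *)
Definition affine_group3 (R : realType) : set 'M[R]_4 :=
  [set M | exists (A : 'M[R]_3) (b : 'cV[R]_3),
      A \in unitmx /\ M = block_mx (1%:M : 'M[R]_1) 0 b A].

Definition mx_act (R : realType) (M : 'M[R]_4) (U : pg_subspace R) :
    pg_subspace R :=
  (linfun (mulmx M : 'cV[R]_4 -> 'cV[R]_4) @: U)%VS.

Definition spread_orbit (R : realType) (Omega : set 'M[R]_4)
    (C : set (pg_subspace R)) : set (set (pg_subspace R)) :=
  [set mx_act w @` C | w in Omega].

Definition O2_admissible (R : realType) (Omega : set 'M[R]_4)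
    (C : set (pg_subspace R)) : Prop :=
  exists Delta : set 'M[R]_4,
    [/\ Delta `<=` Omega, mx_group Delta,
        top_group_iso Delta (@orthogonal_group R 2)
      & forall d, Delta d -> mx_act d @` C = C].

(* (x0, x1, x2, x3) is the quaternion x0 + x1 i + x2 j + x3 k. *)
Definition qmul (R : realType) (p q : 'cV[R]_4) : 'cV[R]_4 :=
  let p0 := coord4 p 0 in let p1 := coord4 p 1 in
  let p2 := coord4 p 2 in let p3 := coord4 p 3 in
  let q0 := coord4 q 0 in let q1 := coord4 q 1 in
  let q2 := coord4 q 2 in let q3 := coord4 q 3 in
  \col_(k < 4)
    [:: p0 * q0 - p1 * q1 - p2 * q2 - p3 * q3;
        p0 * q1 + p1 * q0 + p2 * q3 - p3 * q2;
        p0 * q2 - p1 * q3 + p2 * q0 + p3 * q1;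
        p0 * q3 + p1 * q2 - p2 * q1 + p3 * q0]`_k.

Definition qnorm (R : realType) (q : 'cV[R]_4) : R :=
  Num.sqrt (\sum_k q k 0 ^+ 2).

(* linfun is only meaningful for linear functions. *)
Lemma qmul_is_linear (R : realType) (a : 'cV[R]_4) : linear (qmul a).
Proof.
move=> c u v; apply/colP => -[[|[|[|[|//]]]] lt_k4];
  rewrite !mxE /= /coord4 !mxE; ring.
Qed.

HB.instance Definition _ (R : realType) (a : 'cV[R]_4) :=
  GRing.isLinear.Build R 'cV[R]_4 'cV[R]_4 _ (qmul a) (qmul_is_linear a).

Definition clifford_class (R : realType) (L : pg_subspace R) :
    set (pg_subspace R) :=
  [set (linfun (qmul a) @: L)%VS | a in [set a : 'cV[R]_4 | qnorm a = 1]].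

Definition clifford_parallelism (R : realType) : set (set (pg_subspace R)) :=
  @clifford_class R @` @pg_lines R.

(* Main.v *)
Require Import Defs.
From HB Require Import structures.
From mathcomp Require Import all_boot all_order all_algebra.
From mathcomp Require Import complex.
From mathcomp Require Import all_classical all_reals all_analysis.
From mathcomp Require Import ring lra.

Set Implicit Arguments.
Unset Strict Implicit.
Unset Printing Implicit Defensive.

Import Order.TTheory GRing.Theory Num.Theory.
Import numFieldNormedType.Exports.

Local Open Scope classical_set_scope.
Local Open Scope ring_scope.

(* Regularity of a spread is an incidence property: three lines of the spread
   determine their regulus, which consists of the lines meeting all their common
   transversals. So C is a regular spread in this sense, whatever collineation
   is used to define it.
   The group Omega is bounded, hence preserves a positive definite form; this
   yields a fixed point and, in suitable affine coordinates, Omega <= O(3). The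
   image of a circle under a nontrivial continuous homomorphism to SO(3) is
   the full group of rotations about some axis, and by the intermediate value
   theorem Omega is all of SO(3); likewise the O(2) fixing C becomes the
   stabiliser in SO(3) of a line.
   Invariance under that O(2) determines three lines of C up to a rescaling of
   the first coordinate, which commutes with SO(3); the regulus condition and
   the rotations then force C to consist of the planes qK, where K is the field
   of complex numbers in the quaternions and q runs over the nonzero
   quaternions; this is one class of the Clifford parallelism. Since
   SO(3) acts by automorphisms of the quaternions and is transitive on the pure
   unit quaternions, its orbit on this class is the whole parallelism. *)

(** * Regular spreads *)

Section Lines.
Variable R : realType.
Implicit Types (x y v : 'cV[R]_4) (L A B D T : pg_subspace R) (M : 'M[R]_4).

Definition indep2 x y := forall a b : R, a *: x + b *: y = 0 -> a = 0 /\ b = 0.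

Definition pline x y : pg_subspace R := (<[x]> + <[y]>)%VS.

Lemma mem_pline a b x y : a *: x + b *: y \in pline x y.
Proof. by apply: memv_add; apply: memvZ; rewrite memv_line. Qed.

Lemma mem_plinel x y : x \in pline x y.
Proof. by have := mem_pline 1 0 x y; rewrite scale1r scale0r addr0. Qed.

Lemma mem_pliner x y : y \in pline x y.
Proof. by have := mem_pline 0 1 x y; rewrite scale1r scale0r add0r. Qed.

Lemma plineP v x y : v \in pline x y -> exists a b, v = a *: x + b *: y.
Proof.
by case/memv_addP=> _ /vlineP[a ->] [_ /vlineP[b ->] ->]; exists a, b.
Qed.

Lemma indep2_neq0 x y : indep2 x y -> x != 0 /\ y != 0.
Proof.
move=> xy; split; apply/eqP => z0.
  by have [] := xy 1 0; rewrite ?z0 ?scaler0 ?scale0r ?addr0// => /eqP;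
    rewrite oner_eq0.
by have [] := xy 0 1; rewrite ?z0 ?scaler0 ?scale0r ?addr0// => _ /eqP;
  rewrite oner_eq0.
Qed.

Lemma dim_pline x y : indep2 x y -> \dim (pline x y) = 2%N.
Proof.
move=> xy; have [x0 y0] := indep2_neq0 xy.
rewrite dimv_disjoint_sum ?dim_vline ?x0 ?y0//.
apply/eqP; rewrite -subv0; apply/subvP => v.
rewrite memv_cap => /andP[/vlineP[a ->]] /vlineP[b ab].
have [] := xy a (- b); first by rewrite scaleNr ab subrr.
by move=> ->; rewrite scale0r mem0v.
Qed.

Lemma pline_eq L x y :
  \dim L = 2%N -> x \in L -> y \in L -> indep2 x y -> L = pline x y.
Proof.
move=> L2 xL yL xy; apply/esym/eqP; rewrite eqEdim dim_pline// L2 leqnn andbT.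
by rewrite subv_add -!memvE xL.
Qed.

Lemma line_neq0 L : \dim L = 2%N -> exists2 x, x != 0 & x \in L.
Proof.
move=> L2; exists (vpick L); last exact: memv_pick.
by rewrite vpick0; apply/eqP => L0; rewrite L0 dimv0 in L2.
Qed.

Lemma line_basis L x : \dim L = 2%N -> x != 0 -> x \in L ->
  exists2 y, indep2 x y & L = pline x y.
Proof.
move=> L2 x0 xL.
have /subvPn[y yL yx] : ~~ (L <= <[x]>)%VS.
  by apply/negP => /dimvS; rewrite L2 dim_vline x0.
have xy : indep2 x y.
  move=> a b /eqP; have [->|b0] := eqVneq b 0.
    by rewrite scale0r addr0 scaler_eq0 (negPf x0) orbF => /eqP.
  rewrite addrC addr_eq0 => /eqP /(congr1 (fun v => b^-1 *: v)).
  rewrite scalerA mulVf// scale1r => yE.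
  by rewrite yE -scaleNr scalerA memvZ ?memv_line in yx.
by exists y => //; apply: pline_eq.
Qed.

Lemma mem_mx_act M L v : v \in L -> M *m v \in mx_act M L.
Proof. by move=> vL; apply/memv_imgP; exists v => //; rewrite lfunE. Qed.

Lemma mx_act_pline M x y : mx_act M (pline x y) = pline (M *m x) (M *m y).
Proof. by rewrite /mx_act limgD !limg_line !lfunE. Qed.

Lemma mx_actM M N L : mx_act (M *m N) L = mx_act M (mx_act N L).
Proof.
rewrite /mx_act -limg_comp; congr (_ @: _)%VS.
by apply/lfunP => v; rewrite comp_lfunE !lfunE/= mulmxA.
Qed.

Lemma mx_act1 L : mx_act 1%:M L = L.
Proof.
rewrite /mx_act -[RHS]lim1g; congr (_ @: _)%VS.
by apply/lfunP => v; rewrite !lfunE/= mul1mx.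
Qed.

Lemma dim_mx_act M L : M \in unitmx -> \dim (mx_act M L) = \dim L.
Proof.
move=> Mu; apply: limg_dim_eq; apply/eqP; rewrite -subv0; apply/subvP => v.
rewrite memv_cap memv_ker => /andP[_]; rewrite lfunE/= => /eqP.
by move=> /(congr1 (mulmx (invmx M))); rewrite mulKmx// mulmx0 => ->;
  apply: mem0v.
Qed.

Lemma mx_actS M L T : M \in unitmx ->
  (mx_act M L <= mx_act M T)%VS = (L <= T)%VS.
Proof.
move=> Mu; apply/idP/idP => [|LT]; last exact: limgS.
by move=> /(limgS (linfun (mulmx (invmx M) : 'cV[R]_4 -> 'cV[R]_4)));
  rewrite -/(mx_act _ (mx_act _ _)) -/(mx_act _ (mx_act _ T)) -!mx_actM
    mulVmx// !mx_act1.
Qed.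

Lemma mx_actK M : M \in unitmx -> cancel (@mx_act R M) (@mx_act R (invmx M)).
Proof. by move=> Mu L; rewrite -mx_actM mulVmx// mx_act1. Qed.

Lemma mx_actVK M : M \in unitmx -> cancel (@mx_act R (invmx M)) (@mx_act R M).
Proof. by move=> Mu L; rewrite -mx_actM mulmxV// mx_act1. Qed.

Lemma mx_act_collineation M : M \in unitmx -> collineation (@mx_act R M).
Proof.
move=> Mu; have Mu' : invmx M \in unitmx by rewrite unitmx_inv.
split; last by move=> P L _ _; rewrite mx_actS.
  split=> [P|P Q _ _|P]; rewrite /pg_points /=; first by rewrite dim_mx_act.
    exact: can_inj (mx_actK Mu) _ _.
  by move=> P1; exists (mx_act (invmx M) P); rewrite /= ?dim_mx_act// mx_actVK.
split=> [P|P Q _ _|P]; rewrite /pg_lines /=; first by rewrite dim_mx_act.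
  exact: can_inj (mx_actK Mu) _ _.
by move=> P1; exists (mx_act (invmx M) P); rewrite /= ?dim_mx_act// mx_actVK.
Qed.

Definition meets L T := exists x, [/\ x != 0, x \in L & x \in T].

(* The last clause says that C contains the regulus through any three of its
   lines: that regulus consists of the lines meeting all common transversals. *)
Definition regular_spread (C : set (pg_subspace R)) := [/\
  C `<=` @pg_lines R,
  forall x, x != 0 -> exists2 L, C L & x \in L,
  forall L T x, C L -> C T -> x != 0 -> x \in L -> x \in T -> L = T &
  forall A B D L, C A -> C B -> C D -> A != B -> A != D -> B != D ->
    pg_lines L ->
    (forall T, pg_lines T -> meets T A -> meets T B -> meets T D ->
      meets T L) ->
    C L].

Lemma pointP (P : pg_subspace R) : pg_points P ->
  exists2 x, x != 0 & P = <[x]>%VS.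
Proof.
rewrite /pg_points/= => P1; exists (vpick P).
  by rewrite vpick0; apply/eqP => P0; rewrite P0 dimv0 in P1.
apply/esym/eqP; rewrite eqEdim -memvE memv_pick dim_vline P1 vpick0.
by case: eqP => // P0; rewrite P0 dimv0 in P1.
Qed.

Lemma point_line x : x != 0 -> pg_points <[x]>%VS.
Proof. by move=> x0; rewrite /pg_points/= dim_vline x0. Qed.

(** Every clause of [regular_spread] is about incidence of points and lines. Since a collineation is
    controlled only on these, a nonzero vector is replaced by the point it spans and pulled back by
    surjectivity. *)
Lemma collineation_regular f (C : set (pg_subspace R)) :
  collineation f -> regular_spread C -> regular_spread (f @` C).
Proof.
move=> [[fP fPi fPs] [fL fLi fLs] fI] [CL Cex Cun Creg].
have fm L T : pg_lines L -> pg_lines T -> meets (f L) (f T) <-> meets L T.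
  move=> lL lT; split=> -[x [x0 xL xT]].
    have /fPs[_ /pointP[y y0 ->] fyE] := point_line x0.
    exists y; split => //; rewrite memvE -fI//; try exact: point_line.
      by rewrite fyE -memvE.
    by rewrite fyE -memvE.
  have /fP/pointP[y y0 fyE] := point_line x0.
  by exists y; split => //; rewrite memvE -fyE fI -?memvE//; apply: point_line.
split.
- by move=> _ [L /CL lL <-]; apply: fL.
- move=> x x0; have /fPs[_ /pointP[y y0 ->] fyE] := point_line x0.
  have [L CL' yL] := Cex y y0; exists (f L); first by exists L.
  by rewrite memvE -fyE fI -?memvE//; [apply: point_line|apply: CL].
- move=> _ _ x [L cL <-] [T cT <-] x0 xL xT; congr f.
  have /fPs[_ /pointP[y y0 ->] fyE] := point_line x0.
  by apply: (Cun _ _ y) => //; rewrite memvE -fI ?fyE -?memvE//;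
    [exact: point_line|exact: CL|exact: point_line|exact: CL].
- move=> _ _ _ L' [A cA <-] [B cB <-] [D cD <-] AB AD BD /fLs[L lL <-] tr.
  exists L => //; apply: (Creg A B D) => //.
  + by apply: contra_neq AB => ->.
  + by apply: contra_neq AD => ->.
  + by apply: contra_neq BD => ->.
  move=> T lT /(fm _ _ lT (CL _ cA)) TA /(fm _ _ lT (CL _ cB)) TB
    /(fm _ _ lT (CL _ cD)) TD.
  by apply/(fm _ _ lT lL); apply: tr => //; apply: fL.
Qed.

End Lines.

(** * The complex spread is regular *)

Section Coordinates.
Variable R : realType.
Implicit Types (x y v : 'cV[R]_4) (L A B D T : pg_subspace R).

Definition v4 (a b c d : R) : 'cV[R]_4 := \col_k [:: a; b; c; d]`_k.

Lemma coord4_v4 a b c d k :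
  coord4 (v4 a b c d) k = [:: a; b; c; d]`_(inord k : 'I_4).
Proof. by rewrite /coord4 mxE. Qed.

Lemma coord4_0 a b c d : coord4 (v4 a b c d) 0 = a.
Proof. by rewrite coord4_v4 inordK. Qed.
Lemma coord4_1 a b c d : coord4 (v4 a b c d) 1 = b.
Proof. by rewrite coord4_v4 inordK. Qed.
Lemma coord4_2 a b c d : coord4 (v4 a b c d) 2 = c.
Proof. by rewrite coord4_v4 inordK. Qed.
Lemma coord4_3 a b c d : coord4 (v4 a b c d) 3 = d.
Proof. by rewrite coord4_v4 inordK. Qed.
Definition coord4E := (coord4_0, coord4_1, coord4_2, coord4_3).

Lemma v4_coord x :
  x = v4 (coord4 x 0) (coord4 x 1) (coord4 x 2) (coord4 x 3).
Proof.
apply/colP => -[[|[|[|[|//]]]] lt_k4]; rewrite !mxE /= /coord4;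
  by congr (x _ _); apply/val_inj; rewrite /= inordK.
Qed.

Lemma v4P x : exists a b c d, x = v4 a b c d.
Proof. by do 4!eexists; apply: v4_coord. Qed.

Lemma v4_inj a b c d a' b' c' d' : v4 a b c d = v4 a' b' c' d' ->
  [/\ a = a', b = b', c = c' & d = d'].
Proof.
move=> e; split.
- by rewrite -(coord4_0 a b c d) e coord4_0.
- by rewrite -(coord4_1 a b c d) e coord4_1.
- by rewrite -(coord4_2 a b c d) e coord4_2.
- by rewrite -(coord4_3 a b c d) e coord4_3.
Qed.

Lemma v4D a b c d a' b' c' d' :
  v4 a b c d + v4 a' b' c' d' = v4 (a + a') (b + b') (c + c') (d + d').
Proof. by apply/colP => -[[|[|[|[|//]]]] lt_k4]; rewrite !mxE. Qed.

Lemma v4Z k a b c d : k *: v4 a b c d = v4 (k * a) (k * b) (k * c) (k * d).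
Proof. by apply/colP => -[[|[|[|[|//]]]] lt_k4]; rewrite !mxE. Qed.

Lemma v4_0 : v4 0 0 0 0 = 0.
Proof. by apply/colP => -[[|[|[|[|//]]]] lt_k4]; rewrite !mxE. Qed.

Lemma v4_eq0 a b c d : v4 a b c d = 0 -> [/\ a = 0, b = 0, c = 0 & d = 0].
Proof. by rewrite -v4_0 => /v4_inj. Qed.

Definition mul_i x : 'cV[R]_4 :=
  v4 (- coord4 x 1) (coord4 x 0) (- coord4 x 3) (coord4 x 2).

Lemma complex_coordsD x y a b : complex_coords (a *: x + b *: y) =
  (a%:C)%C *: complex_coords x + (b%:C)%C *: complex_coords y.
Proof.
have [x0 [x1 [x2 [x3 ->]]]] := v4P x; have [y0 [y1 [y2 [y3 ->]]]] := v4P y.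
rewrite !v4Z v4D; apply/colP => -[[|[|//]] lt_k2]; rewrite !mxE /= !coord4E;
  apply/eqP; rewrite eq_complex /=; apply/andP; split; apply/eqP; ring.
Qed.

Lemma complex_coords_inj x y : complex_coords x = complex_coords y -> x = y.
Proof.
have [x0 [x1 [x2 [x3 ->]]]] := v4P x; have [y0 [y1 [y2 [y3 ->]]]] := v4P y.
move=> /colP e.
have := e ord0; have := e (@Ordinal 2 1 isT).
by rewrite !mxE /= !coord4E => -[-> ->] [-> ->].
Qed.

Lemma complex_coords_scale x a b :
  (a +i* b)%C *: complex_coords x = complex_coords (a *: x + b *: mul_i x).
Proof.
have [x0 [x1 [x2 [x3 ->]]]] := v4P x.
rewrite /mul_i !coord4E !v4Z v4D; apply/colP => -[[|[|//]] lt_k2];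
  rewrite !mxE /= !coord4E;
  apply/eqP; rewrite eq_complex /=; apply/andP; split; apply/eqP; ring.
Qed.

Lemma complex_coords0 : complex_coords (0 : 'cV[R]_4) = 0.
Proof. by have := complex_coordsD 0 0 0 0; rewrite !scale0r !addr0. Qed.

Lemma indep2_mul_i x : x != 0 -> indep2 x (mul_i x).
Proof.
move=> x0 a b /(congr1 (@complex_coords R)).
rewrite -complex_coords_scale complex_coords0 => /eqP.
rewrite scaler_eq0 => /orP[|/eqP xE];
  first by rewrite eq_complex/= => /andP[/eqP-> /eqP->].
by case/eqP: x0; apply: complex_coords_inj; rewrite complex_coords0.
Qed.

Lemma mem_complex_line x v :
  (v \in pline x (mul_i x)) = (complex_coords v \in <[complex_coords x]>%VS).
Proof.
apply/idP/vlineP => [/plineP[a [b ->]]|[[a b]]].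
  by exists (a +i* b)%C; rewrite complex_coords_scale.
by rewrite complex_coords_scale => /complex_coords_inj ->; apply: mem_pline.
Qed.

Lemma complex_linesP L :
  complex_lines L <-> exists2 x, x != 0 & L = pline x (mul_i x).
Proof.
split=> [[W W1 LW]|[x x0 ->]]; last first.
  exists <[complex_coords x]>%VS; last exact: mem_complex_line.
  rewrite dim_vline; case: eqP => // xE.
  by case/eqP: x0; apply: complex_coords_inj; rewrite complex_coords0.
pose w := vpick W.
have w0 : w != 0.
  by rewrite vpick0; apply/eqP => W0; rewrite W0 dimv0 in W1.
have WE : W = <[w]>%VS.
  by apply/esym/eqP; rewrite eqEdim -memvE memv_pick dim_vline W1 w0.
pose w_ k := w (inord k) 0.
pose x := v4 (complex.Re (w_ 0%N)) (complex.Im (w_ 0%N))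
             (complex.Re (w_ 1%N)) (complex.Im (w_ 1%N)).
have xw : complex_coords x = w.
  have wE z : z = (complex.Re z +i* complex.Im z)%C :> R[i] by case: z.
  apply/colP => k; have -> : w k 0 = w_ k by rewrite /w_ inord_val.
  by rewrite [RHS]wE mxE; case: k => -[|[|//]] lt_k2; rewrite /= !coord4E.
exists x; first by apply: contra_neq w0 => x0; rewrite -xw x0 complex_coords0.
by apply/vspaceP => v; rewrite LW mem_complex_line xw WE.
Qed.

Lemma complex_lines_mem L x : complex_lines L -> x != 0 -> x \in L ->
  L = pline x (mul_i x).
Proof.
move=> /complex_linesP[y y0 ->{L}] x0; rewrite mem_complex_line => xy.
apply/vspaceP => v; rewrite !mem_complex_line.
suff -> : <[complex_coords x]>%VS = <[complex_coords y]>%VS by [].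
apply/eqP; rewrite eqEdim -memvE xy !dim_vline.
suff -> : complex_coords x != 0 by rewrite leq_b1.
by apply: contra_neq x0 => x0; apply: complex_coords_inj;
  rewrite complex_coords0.
Qed.

Lemma mul_iD a b x y : mul_i (a *: x + b *: y) = a *: mul_i x + b *: mul_i y.
Proof.
have [x0 [x1 [x2 [x3 ->]]]] := v4P x; have [y0 [y1 [y2 [y3 ->]]]] := v4P y.
by rewrite /mul_i !v4Z !v4D !coord4E; congr v4; ring.
Qed.

(** For the regulus clause, write a vector of D as w1 + w2 with w1 in A and w2 in B. For each
    complex z other than 0 the real line through z w1 and z w2 is a common transversal; meeting it
    for z = 1, i and 1 + i already forces L to be complex. *)
Lemma complex_lines_regular : regular_spread (@complex_lines R).
Proof.
split.
- move=> _ /complex_linesP[x x0 ->]; exact: dim_pline (indep2_mul_i x0).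
- move=> x x0; exists (pline x (mul_i x)); last exact: mem_plinel.
  by apply/complex_linesP; exists x.
- move=> L T x cL cT x0 xL xT.
  by rewrite (complex_lines_mem cL x0 xL) (complex_lines_mem cT x0 xT).
move=> A B D L cA cB cD AB AD BD lL tr.
have un L1 L2 x : complex_lines L1 -> complex_lines L2 -> L1 != L2 ->
    x \in L1 -> x \in L2 -> x = 0.
  move=> c1 c2 L12 x1 x2; apply: contra_neq_eq L12 => x0.
  by rewrite (complex_lines_mem c1 x0 x1) (complex_lines_mem c2 x0 x2).
have dimc L1 : complex_lines L1 -> \dim L1 = 2%N.
  by move=> /complex_linesP[x x0 ->]; apply: dim_pline (indep2_mul_i x0).
have [d d0 dD] := line_neq0 (dimc _ cD).
have ABf : (A + B = fullv)%VS.
  apply/eqP; rewrite eqEdim subvf dimvf /dim /= dimv_disjoint_sum ?dimc//.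
  apply/eqP; rewrite -subv0; apply/subvP => v; rewrite memv_cap => /andP[vA vB].
  by rewrite (un A B v)// mem0v.
have /memv_addP[w1 w1A [w2 w2B dE]] : d \in (A + B)%VS by rewrite ABf memvf.
have w10 : w1 != 0.
  apply: contra_neq d0 => w10; apply: (un B D) => //.
  by rewrite dE w10 add0r.
have w20 : w2 != 0.
  apply: contra_neq d0 => w20; apply: (un A D) => //.
  by rewrite dE w20 addr0.
have AE := complex_lines_mem cA w10 w1A.
have BE := complex_lines_mem cB w20 w2B.
have DE := complex_lines_mem cD d0 dD.
have free4 a b c e :
    (a *: w1 + b *: mul_i w1) + (c *: w2 + e *: mul_i w2) = 0 ->
    [/\ a = 0, b = 0, c = 0 & e = 0].
  move=> /eqP; rewrite addr_eq0 => /eqP uv.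
  have u0 : a *: w1 + b *: mul_i w1 = 0.
    apply: (un A B) => //; first by rewrite AE mem_pline.
    by rewrite uv rpredN BE mem_pline.
  have v0 : c *: w2 + e *: mul_i w2 = 0 by rewrite -[LHS]opprK -uv u0 oppr0.
  by have [-> ->] := indep2_mul_i w10 u0; have [-> ->] := indep2_mul_i w20 v0.
(* Here z = p + i q; the transversal meets D in z (w1 + w2). *)
have trz p q : p != 0 \/ q != 0 -> exists s t, (s != 0 \/ t != 0) /\
    s *: (p *: w1 + q *: mul_i w1) + t *: (p *: w2 + q *: mul_i w2) \in L.
  move=> pq0.
  set u1 := p *: w1 + q *: mul_i w1; set u2 := p *: w2 + q *: mul_i w2.
  have pq s : s * p = 0 -> s * q = 0 -> s = 0.
    move=> /eqP + /eqP; rewrite !mulf_eq0.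
    by case: pq0 => /negPf->; rewrite !orbF => /eqP + /eqP.
  have u12 : indep2 u1 u2.
    move=> s t; rewrite !scalerDr !scalerA => /free4[sp sq tp tq].
    by split; apply: pq.
  have [u10 u20] := indep2_neq0 u12.
  have uD : u1 + u2 = p *: d + q *: mul_i d.
    have := mul_iD 1 1 w1 w2; rewrite !scale1r dE => ->.
    by rewrite !scalerDr addrACA.
  have [x [x0 /plineP[s [t xE]] xL]] : meets (pline u1 u2) L.
    apply: tr; first exact: dim_pline.
    - by exists u1; rewrite u10 mem_plinel AE mem_pline.
    - by exists u2; rewrite u20 mem_pliner BE mem_pline.
    exists (u1 + u2); split.
    + apply/eqP => u0; have [] := u12 1 1; rewrite ?scale1r//.
      by move=> /eqP; rewrite oner_eq0.
    + by rewrite rpredD ?mem_plinel ?mem_pliner.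
    + by rewrite uD DE mem_pline.
  exists s, t; rewrite -xE; split => //.
  have [s0|] := eqVneq s 0; last by left.
  have [t0|] := eqVneq t 0; last by right.
  by rewrite xE s0 t0 !scale0r addr0 eqxx in x0.
have [|s1 [t1 [st1 L1]]] := trz 1 0; first by left; rewrite oner_eq0.
have [|s2 [t2 [st2 L2]]] := trz 0 1; first by right; rewrite oner_eq0.
have [|s3 [t3 [st3 L3]]] := trz 1 1; first by left; rewrite oner_eq0.
rewrite !scale1r !scale0r ?addr0 ?add0r in L1 L2 L3.
have ind : indep2 (s1 *: w1 + t1 *: w2) (s2 *: mul_i w1 + t2 *: mul_i w2).
  move=> a b; rewrite !scalerDr !scalerA addrACA => /free4[as1 bs2 at1 bt2].
  split; apply/eqP.
    move: as1 at1 => /eqP + /eqP; rewrite !mulf_eq0.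
    by case: st1 => /negPf->; rewrite !orbF.
  move: bs2 bt2 => /eqP + /eqP; rewrite !mulf_eq0.
  by case: st2 => /negPf->; rewrite !orbF.
have /plineP[a [b x3E]] : s3 *: (w1 + mul_i w1) + t3 *: (w2 + mul_i w2) \in
    pline (s1 *: w1 + t1 *: w2) (s2 *: mul_i w1 + t2 *: mul_i w2).
  by rewrite -(pline_eq lL L1 L2 ind).
(* The vector found for z = 1 + i is a combination of those found for 1 and i. Comparing
   coefficients shows that y = s3 w1 + t3 w2 and i y are multiples of the latter two, so both lie in
   L. *)
have /free4[/subr0_eq e1 /subr0_eq e2 /subr0_eq e3 /subr0_eq e4] :
    ((s3 - a * s1) *: w1 + (s3 - b * s2) *: mul_i w1) +
    ((t3 - a * t1) *: w2 + (t3 - b * t2) *: mul_i w2) = 0.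
  move/eqP: x3E; rewrite -subr_eq0 => /eqP <-.
  move: (mul_i w1) (mul_i w2) => u v.
  by apply/colP => k; rewrite !mxE; ring.
pose y := s3 *: w1 + t3 *: w2.
have y0 : y != 0.
  apply/eqP => y0; have [|] := free4 s3 0 t3 0.
    by rewrite !scale0r !addr0.
  by move=> s30 _ t30 _; case: st3; rewrite ?s30 ?t30 eqxx.
have yL : y \in L.
  suff -> : y = a *: (s1 *: w1 + t1 *: w2) by apply: memvZ.
  by rewrite /y e1 e3 scalerDr !scalerA.
have iyL : mul_i y \in L.
  suff -> : mul_i y = b *: (s2 *: mul_i w1 + t2 *: mul_i w2) by apply: memvZ.
  by rewrite /y mul_iD e2 e4 scalerDr !scalerA.
apply/complex_linesP; exists y => //.
exact: pline_eq lL yL iyL (indep2_mul_i y0).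
Qed.

Lemma complex_spread_regular (C : set (pg_subspace R)) :
  complex_spread C -> regular_spread C.
Proof.
by case=> f cf ->; apply: collineation_regular cf complex_lines_regular.
Qed.

End Coordinates.

(** * Rotation matrices *)

Section Rotations.
Variable R : realType.
Implicit Types (A B P : 'M[R]_3) (s t : R).
Local Notation SO3 := (@special_orthogonal_group R 3).

Definition m3 (a b c d e f g h i : R) : 'M[R]_3 :=
  \matrix_(j, k) (nth [::] [:: [:: a; b; c]; [:: d; e; f]; [:: g; h; i]] j)`_k.

Local Notation i1 := (@Ordinal 3 1 isT).
Local Notation i2 := (@Ordinal 3 2 isT).

Lemma m3E A : A = m3 (A ord0 ord0) (A ord0 i1) (A ord0 i2)
  (A i1 ord0) (A i1 i1) (A i1 i2) (A i2 ord0) (A i2 i1) (A i2 i2).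
Proof.
by apply/matrixP => -[[|[|[|//]]] ?] [[|[|[|//]]] ?]; rewrite !mxE /=;
  congr (A _ _); apply/val_inj.
Qed.

Lemma m3P A : exists a b c d e f g h i, A = m3 a b c d e f g h i.
Proof. by do 9!eexists; apply: m3E. Qed.

Lemma m3_inj a b c d e f g h i a' b' c' d' e' f' g' h' i' :
  m3 a b c d e f g h i = m3 a' b' c' d' e' f' g' h' i' ->
  [/\ [/\ a = a', b = b' & c = c'], [/\ d = d', e = e' & f = f']
    & [/\ g = g', h = h' & i = i']].
Proof.
move=> /matrixP E.
have := E ord0 ord0; have := E ord0 i1; have := E ord0 i2.
have := E i1 ord0; have := E i1 i1; have := E i1 i2.
have := E i2 ord0; have := E i2 i1; have := E i2 i2.
by rewrite !mxE.
Qed.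

Lemma m3_1 : 1%:M = m3 1 0 0 0 1 0 0 0 1.
Proof.
by apply/matrixP => -[[|[|[|//]]] ?] [[|[|[|//]]] ?]; rewrite !mxE.
Qed.

Lemma m3_mul a b c d e f g h i a' b' c' d' e' f' g' h' i' :
  m3 a b c d e f g h i *m m3 a' b' c' d' e' f' g' h' i' =
  m3
    (a * a' + b * d' + c * g') (a * b' + b * e' + c * h')
      (a * c' + b * f' + c * i')
    (d * a' + e * d' + f * g') (d * b' + e * e' + f * h')
      (d * c' + e * f' + f * i')
    (g * a' + h * d' + i * g') (g * b' + h * e' + i * h')
      (g * c' + h * f' + i * i').
Proof.
by apply/matrixP => -[[|[|[|//]]] ?] [[|[|[|//]]] ?];
  rewrite !mxE !big_ord_recl big_ord0 !mxE /= addr0 addrA.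
Qed.

Lemma m3_tr a b c d e f g h i :
  (m3 a b c d e f g h i)^T = m3 a d g b e h c f i.
Proof.
by apply/matrixP => -[[|[|[|//]]] ?] [[|[|[|//]]] ?]; rewrite !mxE.
Qed.

Lemma det_m3 a b c d e f g h i : \det (m3 a b c d e f g h i) =
  a * (e * i - f * h) - b * (d * i - f * g) + c * (d * h - e * g).
Proof.
rewrite (expand_det_row _ ord0) !big_ord_recl big_ord0 /cofactor.
rewrite !(expand_det_row _ ord0) !big_ord_recl !big_ord0 /cofactor.
rewrite !det_mx11 !mxE /=; ring.
Qed.

Lemma SO3_trl A : SO3 A -> A^T *m A = 1%:M.
Proof. by case=> /mulmx1C. Qed.

Lemma SO3_1 : SO3 1%:M.
Proof. by split; rewrite ?trmx1 ?mul1mx ?det1. Qed.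

Lemma SO3_mul A B : SO3 A -> SO3 B -> SO3 (A *m B).
Proof.
move=> [AA dA] [BB dB]; split; last by rewrite det_mulmx dA dB mulr1.
by rewrite trmx_mul mulmxA -(mulmxA A) BB mulmx1.
Qed.

Lemma SO3_tr A : SO3 A -> SO3 A^T.
Proof. by move=> sA; split; rewrite ?trmxK ?SO3_trl// det_tr; case: sA. Qed.

Lemma SO3_conj A P : SO3 A -> SO3 P -> SO3 (P^T *m A *m P).
Proof. by move=> sA sP; exact: SO3_mul (SO3_mul (SO3_tr sP) sA) sP. Qed.

(* A rotation matrix equals its cofactor matrix. *)
Lemma SO3_m3 a b c d e f g h i : SO3 (m3 a b c d e f g h i) ->
  [/\ [/\ a * a + b * b + c * c = 1, d * d + e * e + f * f = 1
        & g * g + h * h + i * i = 1],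
      [/\ a * a + d * d + g * g = 1, b * b + e * e + h * h = 1
        & c * c + f * f + i * i = 1],
      [/\ a * b + d * e + g * h = 0, a * c + d * f + g * i = 0
        & b * c + e * f + h * i = 0]
    & [/\ [/\ a = e * i - f * h, b = f * g - d * i & c = d * h - e * g],
          [/\ d = h * c - i * b, e = i * a - g * c & f = g * b - h * a]
        & [/\ g = b * f - c * e, h = c * d - a * f & i = a * e - b * d]]].
Proof.
move=> sA; have [AA dA] := sA.
have := SO3_trl sA; have := AA.
rewrite m3_tr !m3_mul m3_1 => /m3_inj[[r1 _ _] [_ r2 _] [_ _ r3]].
move=> /m3_inj[[c1 c12 c13] [_ c2 c23] [_ _ c3]].
pose adj := m3 (e * i - f * h) (h * c - i * b) (b * f - c * e)
  (f * g - d * i) (i * a - g * c) (c * d - a * f)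
  (d * h - e * g) (g * b - h * a) (a * e - b * d).
have /m3_inj[[? ? ?] [? ? ?] [? ? ?]] : m3 a d g b e h c f i = adj.
  rewrite -[LHS]mulmx1 -m3_tr.
  suff <- : m3 a b c d e f g h i *m adj = 1%:M.
    by rewrite mulmxA SO3_trl// mul1mx.
  by move: dA; rewrite det_m3 m3_mul m3_1 => dA; congr m3; rewrite -?dA; ring.
by split.
Qed.

Definition rotx t := m3 1 0 0 0 (cos t) (- sin t) 0 (sin t) (cos t).
(** With this sign the first axis turns towards the third, against the right-hand rule. *)
Definition roty t := m3 (cos t) 0 (- sin t) 0 1 0 (sin t) 0 (cos t).
Definition rotz t := m3 (cos t) (- sin t) 0 (sin t) (cos t) 0 0 0 1.

Let cs t : cos t * cos t + sin t * sin t = 1.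
Proof. by rewrite -!expr2 cos2Dsin2. Qed.

Lemma SO3_rotx t : SO3 (rotx t).
Proof.
split; rewrite ?det_m3 ?m3_tr ?m3_mul ?m3_1; last by have := cs t; lra.
by congr m3; have := cs t; lra.
Qed.

Lemma SO3_roty t : SO3 (roty t).
Proof.
split; rewrite ?det_m3 ?m3_tr ?m3_mul ?m3_1; last by have := cs t; lra.
by congr m3; have := cs t; lra.
Qed.

Lemma SO3_rotz t : SO3 (rotz t).
Proof.
split; rewrite ?det_m3 ?m3_tr ?m3_mul ?m3_1; last by have := cs t; lra.
by congr m3; have := cs t; lra.
Qed.

Lemma rotxD s t : rotx (s + t) = rotx s *m rotx t.
Proof. by rewrite /rotx cosD sinD m3_mul; congr m3; ring. Qed.

Lemma rotzD s t : rotz (s + t) = rotz s *m rotz t.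
Proof. by rewrite /rotz cosD sinD m3_mul; congr m3; ring. Qed.

Lemma rotxN t : rotx (- t) = (rotx t)^T.
Proof. by rewrite /rotx m3_tr cosN sinN opprK. Qed.

Lemma rotx_pi : rotx pi = m3 1 0 0 0 (-1) 0 0 0 (-1).
Proof. by rewrite /rotx cospi sinpi oppr0. Qed.

Lemma roty_pi : roty pi = m3 (-1) 0 0 0 1 0 0 0 (-1).
Proof. by rewrite /roty cospi sinpi oppr0. Qed.

Lemma rotx0 : rotx 0 = 1%:M.
Proof. by rewrite /rotx cos0 sin0 oppr0 m3_1. Qed.

Lemma roty0 : roty 0 = 1%:M.
Proof. by rewrite /roty cos0 sin0 oppr0 m3_1. Qed.

(** [acos c] is the angle up to sign, and the sign is that of s. The compact interval later serves
    to bound continuous images of SO(3). *)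
Lemma angle_exists (c s : R) : c * c + s * s = 1 ->
  exists2 t : R, t \in `[- pi, pi] & c = cos t /\ s = sin t.
Proof.
move=> cs1; have c1 : -1 <= c <= 1 by apply/andP; split; nra.
have ca : cos (acos c) = c by apply: acosK; rewrite in_itv.
have a0 := acos_ge0 c1; have api := acos_lepi c1.
have sa : sin (acos c) = `|s|.
  rewrite sin_acos// (_ : 1 - c ^+ 2 = s ^+ 2) ?sqrtr_sqr//.
  by rewrite -cs1 !expr2 addrAC subrr add0r.
have [s0|s0] := leP 0 s.
  exists (acos c); last by rewrite ca sa ger0_norm.
  by rewrite in_itv/= api andbT; apply: le_trans a0; rewrite oppr_le0 pi_ge0.
exists (- acos c); last by rewrite cosN sinN ca sa ltr0_norm// opprK.
by rewrite in_itv/= lerN2 api /=; apply: le_trans (pi_ge0 _); rewrite oppr_le0.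
Qed.

Lemma sqr_sum_eq0 (x y : R) : x * x + y * y = 0 -> x = 0 /\ y = 0.
Proof.
by move/eqP; rewrite -!expr2 paddr_eq0 ?sqr_ge0// !sqrf_eq0 =>
  /andP[/eqP-> /eqP->].
Qed.

(** The first row and column are unit vectors, so their other entries vanish; the cofactor relations
    then give the lower block the shape of a plane rotation. *)
Lemma rotx_exists A : SO3 A -> A ord0 ord0 = 1 ->
  exists2 t : R, t \in `[- pi, pi] & A = rotx t.
Proof.
have [a [b [c [d [e [f [g [h [i ->]]]]]]]]] := m3P A.
rewrite mxE /= => /SO3_m3[[r1 _ _] [c1 c2 _] _ [_ [_ eE fE] _]] a1.
rewrite a1 in r1 c1 eE fE.
have [b0 c0] : b = 0 /\ c = 0 by apply: sqr_sum_eq0; lra.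
have [d0 g0] : d = 0 /\ g = 0 by apply: sqr_sum_eq0; lra.
rewrite b0 c0 g0 in c2 eE fE.
have ie : i = e by lra.
have fh : f = - h by lra.
have [t tI [et ht]] : exists2 t : R, t \in `[- pi, pi] & e = cos t /\ h = sin t.
  by apply: angle_exists; lra.
by exists t => //; rewrite /rotx a1 b0 c0 d0 g0 ie fh et ht.
Qed.

(** Spherical coordinates: q is the angle with the first axis, p the azimuth around it, taken to be
    0 at the poles. *)
Lemma SO3_transitive (a b c : R) : a * a + b * b + c * c = 1 ->
  exists p q : R, let P := rotx p *m rotz q in
    [/\ P ord0 ord0 = a, P i1 ord0 = b & P i2 ord0 = c].
Proof.
move=> abc; pose s := Num.sqrt (b * b + c * c).
have bc0 : 0 <= b * b + c * c by nra.
have ss : s * s = b * b + c * c by rewrite -expr2 sqr_sqrtr.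
have [q _ [aq sq]] : exists2 q, q \in `[- pi, pi] & a = cos q /\ s = sin q.
  by apply: angle_exists; lra.
have [p [bp cp]] : exists p, b = cos p * s /\ c = sin p * s.
  have [s0|s0] := eqVneq s 0.
    have [-> ->] : b = 0 /\ c = 0 by apply: sqr_sum_eq0; rewrite -ss s0 mulr0.
    by exists 0; rewrite s0 !mulr0.
  have [|p _ [bp cp]] := @angle_exists (b / s) (c / s).
    by rewrite mulf_div [c / s * _]mulf_div -mulrDl -ss divff// mulf_neq0.
  by exists p; rewrite -bp -cp !divfK.
by exists p, q; rewrite /= /rotx /rotz m3_mul !mxE /= -sq; split; lra.
Qed.

(** Match the first column of A by a product of two rotations; what remains fixes the first basis
    vector. *)
Lemma Euler_decomposition A : SO3 A -> exists p q r : R,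
  r \in `[- pi, pi] /\ A = rotx p *m rotz q *m rotx r.
Proof.
move=> sA; have [a [b [c [d [e [f [g [h [i AE]]]]]]]]] := m3P A.
have /SO3_m3[_ [c1 _ _] _ _] : SO3 (m3 a b c d e f g h i) by rewrite -AE.
have [p [q]] := SO3_transitive c1; set P := rotx p *m rotz q.
move=> /= [P0 P1 P2].
have sP : SO3 P by apply: SO3_mul (SO3_rotx p) (SO3_rotz q).
have [|r rI rE] := rotx_exists (SO3_mul (SO3_tr sP) sA).
  have -> : P^T = m3 a d g (P ord0 i1) (P i1 i1) (P i2 i1)
      (P ord0 i2) (P i1 i2) (P i2 i2) by rewrite {1}(m3E P) m3_tr P0 P1 P2.
  by rewrite AE m3_mul mxE.
exists p, q, r; split => //.
by rewrite -/P -rE mulmxA; case: sP => -> _; rewrite mul1mx.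
Qed.

End Rotations.

(** * Circle subgroups of SO(3) *)

Section EntrywiseContinuity.
Variable R : realType.

(* Entrywise continuity is equivalent to continuity for matrices; the product
   of rectangular matrices is easier to handle in this form. *)
Definition mxcont (T : topologicalType) m n (F : T -> 'M[R]_(m, n)) :=
  forall i j, continuous (fun t => F t i j).

Lemma mxcont_cst (T : topologicalType) m n (A : 'M[R]_(m, n)) :
  mxcont (fun=> A : 'M[R]_(m, n)) (T := T).
Proof. by move=> i j t; apply: cvg_cst. Qed.

Lemma mxcont_mul (T : topologicalType) m n p
    (F : T -> 'M[R]_(m, n)) (G : T -> 'M[R]_(n, p)) :
  mxcont F -> mxcont G -> mxcont (fun t => F t *m G t).
Proof.
move=> cF cG i j; under [X in continuous X]eq_fun do rewrite mxE.
apply: (@continuous_big _ _ _ _ _ add_continuous) => k _ t.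
by apply: continuousM; [apply: cF|apply: cG].
Qed.

Arguments mxcont_cst {T m n} A _ _.
Arguments mxcont_mul {T m n p F G} _ _ _ _.

Lemma mxcontP (T : topologicalType) m n (F : T -> 'M[R]_(m, n)) :
  mxcont F -> continuous F.
Proof.
move=> cF t A /nbhs_ballP[e e0 eA].
suff H : \forall s \near t, forall i j, ball (F t i j) e (F s i j).
  by apply: filterS H => s st; apply: eA; split.
apply: filter_forall => i; apply: filter_forall => j.
by have /cvg_ball := cF i j t; apply.
Qed.

(** A topological isomorphism of matrix groups is continuous only within its group; along a
    continuous family inside the group this becomes plain continuity, as the intermediate value
    theorem requires. *)
Lemma mxcont_within (T : topologicalType) m n p q (S : set 'M[R]_(m, n))
    (g : 'M[R]_(m, n) -> 'M[R]_(p, q)) (F : T -> 'M[R]_(m, n)) :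
  {within S, continuous g} -> mxcont F -> (forall t, S (F t)) ->
  mxcont (g \o F).
Proof.
move=> /subspace_continuousP cg cF SF i j t.
have cgF : g \o F @ t --> g (F t).
  apply: cvg_trans (cg _ (SF t)) => A /= gA.
  have H : \forall s \near t, S (F s) ->
    A (g (F s)) by apply: mxcontP cF _ _ gA.
  by apply: filterS H => s; apply.
exact: (cvg_comp _ _ cgF (@coord_continuous R _ _ i j (g (F t)))).
Qed.

End EntrywiseContinuity.
Arguments mxcont_cst {R T m n} A _ _.
Arguments mxcont_mul {R T m n p F G} _ _ _ _.

(** * Homomorphic images of the circle in SO(3) *)

Section Circle.
Variable R : realType.
Implicit Types (A B P : 'M[R]_3) (s t : R).
Local Notation SO3 := (@special_orthogonal_group R 3).
Local Notation i1 := (@Ordinal 3 1 isT).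
Local Notation i2 := (@Ordinal 3 2 isT).

Lemma mxcont_rotx : mxcont (@rotx R).
Proof.
move=> -[[|[|[|//]]] ?] [[|[|[|//]]] ?] t; rewrite /rotx;
  under [X in continuous_at _ X]eq_fun do rewrite mxE /=;
    rewrite /continuous_at /=;
  do ?[exact: cvg_cst|exact: continuous_cos|exact: continuous_sin
      |apply: cvgN; exact: continuous_sin].
Qed.

Lemma mxcont_roty : mxcont (@roty R).
Proof.
move=> -[[|[|[|//]]] ?] [[|[|[|//]]] ?] t; rewrite /roty;
  under [X in continuous_at _ X]eq_fun do rewrite mxE /=;
    rewrite /continuous_at /=;
  do ?[exact: cvg_cst|exact: continuous_cos|exact: continuous_sin
      |apply: cvgN; exact: continuous_sin].
Qed.

Lemma mxcont_rotz : mxcont (@rotz R).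
Proof.
move=> -[[|[|[|//]]] ?] [[|[|[|//]]] ?] t; rewrite /rotz;
  under [X in continuous_at _ X]eq_fun do rewrite mxE /=;
    rewrite /continuous_at /=;
  do ?[exact: cvg_cst|exact: continuous_cos|exact: continuous_sin
      |apply: cvgN; exact: continuous_sin].
Qed.

Lemma ord3_cases (k : 'I_3) : [\/ k = ord0, k = i1 | k = i2].
Proof.
by case: k => -[|[|[|//]]] ?; [apply: Or31|apply: Or32|apply: Or33];
  apply/val_inj.
Qed.

Lemma SO3_conjM A B P : SO3 P ->
  (P^T *m A *m P) *m (P^T *m B *m P) = P^T *m (A *m B) *m P.
Proof.
by move=> [PP _]; rewrite !mulmxA -[X in X *m B]mulmxA PP mulmx1.
Qed.

Lemma SO3_conj1 P : SO3 P -> P^T *m 1%:M *m P = 1%:M.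
Proof. by move=> /SO3_trl; rewrite mulmx1. Qed.

Lemma SO3_conj_inj A B P : SO3 P -> P^T *m A *m P = P^T *m B *m P -> A = B.
Proof.
move=> [PP _] /(congr1 (fun X => P *m X *m P^T)).
by rewrite !mulmxA PP !mul1mx -!mulmxA PP !mulmx1.
Qed.

Lemma SO3_idem A : SO3 A -> A *m A = A -> A = 1%:M.
Proof.
by move=> sA /(congr1 (mulmx A^T)); rewrite mulmxA SO3_trl// mul1mx.
Qed.

(** Since A is an involution, it fixes every column of A + 1, and these are not all zero because -1
    has determinant -1. Moving such a column to the first axis turns A into some [rotx t] with
    square 1. *)
Lemma involution_axis A : SO3 A -> A *m A = 1%:M -> A <> 1%:M ->
  exists2 P, SO3 P & P^T *m A *m P = rotx pi.
Proof.
move=> sA AA A1.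
have [j [u0]] : exists j, col j (A + 1%:M) != 0.
  apply/not_existsP => nj; case: sA => _.
  have -> : A = (-1)%:M.
    apply/eqP; rewrite -subr_eq0 -scalemx1 scaleN1r opprK;
      apply/eqP/matrixP => i j.
    have /negP/negPn/eqP/colP/(_ i) := nj j.
    by rewrite mxE [RHS]mxE mxE => ->; rewrite mxE.
  by rewrite det_scalar !exprS expr0 mulr1 mulrNN mulr1; lra.
pose u := col j (A + 1%:M).
have Au : A *m u = u by rewrite /u !colE mulmxA mulmxDr mulmx1 AA addrC.
pose x k := u k 0.
pose n := Num.sqrt (x ord0 * x ord0 + x i1 * x i1 + x i2 * x i2).
have n0 : n != 0.
  rewrite sqrtr_eq0 -ltNge; have /eqP/colP nz : u != 0 := u0.
  have [x0 y0 z0] : [/\ 0 <= x ord0 * x ord0,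
    0 <= x i1 * x i1 & 0 <= x i2 * x i2].
    by rewrite -!expr2 !sqr_ge0.
  rewrite lt_neqAle eq_sym !addr_ge0// andbT.
  rewrite paddr_eq0 ?addr_ge0// paddr_eq0//; apply/negP.
  rewrite -!expr2 !sqrf_eq0 => /andP[/andP[/eqP x1 /eqP y1] /eqP z1].
  by apply: nz => k; rewrite [RHS]mxE; case: (ord3_cases k) => ->.
have nn : n * n = x ord0 * x ord0 + x i1 * x i1 + x i2 * x i2.
  by rewrite -expr2 sqr_sqrtr// -!expr2 !addr_ge0 ?sqr_ge0.
have [|p [q /=]] :=
  @SO3_transitive R (n^-1 * x ord0) (n^-1 * x i1) (n^-1 * x i2).
  transitivity (n^-1 * n^-1 * (n * n)); first by rewrite nn; ring.
  by field.
set P := rotx p *m rotz q => -[P0 P1 P2].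
have sP : SO3 P := SO3_mul (SO3_rotx p) (SO3_rotz q).
have Pu : col ord0 P = n^-1 *: u.
  by apply/colP => k; rewrite [LHS]mxE [RHS]mxE; case: (ord3_cases k) => ->.
exists P => //.
have B00 : (P^T *m A *m P) ord0 ord0 = 1.
  have /colP/(_ ord0) : col ord0 (P^T *m A *m P) = col ord0 1%:M.
    have AP : A *m col ord0 P = col ord0 P by rewrite Pu -scalemxAr Au.
    by rewrite -(SO3_trl sP) [RHS]colE -[RHS]mulmxA -[P *m _]colE -AP !colE
      !mulmxA.
  by rewrite !mxE.
have [t _ tE] := rotx_exists (SO3_conj sA sP) B00.
have : rotx t *m rotx t = 1%:M by rewrite -tE SO3_conjM// AA SO3_conj1.
rewrite tE /rotx m3_mul m3_1 => /m3_inj[_ [_ c1 _] _].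
have cs : cos t * cos t + sin t * sin t = 1 by rewrite -!expr2 cos2Dsin2.
have st : sin t = 0 by apply/eqP; rewrite -sqrf_eq0 expr2; apply/eqP; lra.
have /eqP : (cos t - 1) * (cos t + 1) = 0 by rewrite st in cs; lra.
rewrite mulf_eq0 subr_eq0 addr_eq0 => /orP[/eqP ct|/eqP ct].
  exfalso; apply: A1; apply: (SO3_conj_inj sP).
  by rewrite tE SO3_conj1// /rotx m3_1 ct st oppr0.
by rewrite -/(rotx pi) rotx_pi ct st oppr0.
Qed.

(* The circle group acts on its rotation axis through squares, hence trivially;
   by the intermediate value theorem all angles occur. *)
Lemma circle_normal_form (h : R -> 'M[R]_3) (E : 'M[R]_3) :
  (forall t, SO3 (h t)) -> (forall s t, h (s + t) = h s *m h t) ->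
  mxcont h -> h (pi + pi) = 1%:M -> h pi <> 1%:M ->
  SO3 E -> (forall t, E *m h t = h (- t) *m E) ->
  exists P, [/\ SO3 P, forall s, exists t, P^T *m h t *m P = rotx s
    & (P^T *m E *m P) ord0 ord0 = -1].
Proof.
move=> sh hD ch h2 h1 sE Eh.
have [|P sP HP] := involution_axis (sh pi) _ h1; first by rewrite -hD.
pose k t := P^T *m h t *m P; pose F := P^T *m E *m P.
have sk t : SO3 (k t) := SO3_conj (sh t) sP.
have kD s t : k (s + t) = k s *m k t by rewrite /k SO3_conjM// hD.
have Fk t : F *m k t = k (- t) *m F by rewrite /k /F !SO3_conjM// Eh.
have k0 : k 0 = 1%:M by apply: SO3_idem (sk 0) _; rewrite -kD addr0.
have kpi : k pi = m3 1 0 0 0 (-1) 0 0 0 (-1) by rewrite -rotx_pi.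
have kNpi : k (- pi) = k pi.
  by rewrite -[LHS]mulmx1 -(SO3_conj1 sP) -h2 -/(k _) -kD addKr.
(* Commuting with diag(1, -1, -1) reduces the first row to (1, 0, 0) or (-1, 0, 0). *)
have comm A : SO3 A -> A *m k pi = k pi *m A ->
      A ord0 ord0 * A ord0 ord0 = 1 /\ (A *m A) ord0 ord0 = 1.
  have [a [b [c [d [e [f [g [l [m ->]]]]]]]]] := m3P A.
  move=> /SO3_m3[[r1 _ _] _ _ _]; rewrite kpi !m3_mul !mxE /=.
  move=> /m3_inj[[_ b0 c0] _ _].
  have {}b0 : b = 0 by lra.
  have {}c0 : c = 0 by lra.
  by rewrite b0 c0 in r1 *; split; lra.
have kx t : exists s, k t = rotx s.
  (* [k t] is the square of [k (t / 2)], which commutes with [k pi]. *)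
  suff /(rotx_exists (sk t))[s _ ->] : k t ord0 ord0 = 1 by exists s.
  have -> : t = t / 2 + t / 2 by field.
  by have /comm := sk (t / 2); rewrite -!kD addrC => /(_ erefl)[].
have kN t : k (- t) = (k t)^T.
  by case: (sk t) => kk _; rewrite -[LHS]mulmx1 -kk mulmxA -kD addNr k0 mul1mx.
exists P; split => // [s|].
  have cf0 := mxcont_mul (mxcont_cst P^T) ch.
  have cf := mxcont_mul cf0 (mxcont_cst P).
  have cf' : {within `[0, pi], continuous (fun t => k t i1 i1)}.
    by apply: continuous_subspaceT; exact: cf i1 i1.
  (* The middle entry runs from 1 at 0 to -1 at pi, so it takes the value cos s; the sine then
     agrees up to sign, and passing from t to -t corrects the sign. *)
  have [|t _ kt] := IVT (v := cos s) (pi_ge0 R) cf'.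
    have N11 : -1 <= 1 :> R by lra.
    by rewrite k0 kpi m3_1 !mxE /= (min_r N11) (max_l N11) cos_geN1 cos_le1.
  have [s' tE] := kx t.
  have cc : cos s' = cos s by rewrite -kt tE mxE.
  have /eqP : (sin s - sin s') * (sin s + sin s') = 0.
    have := cos2Dsin2 s; have := cos2Dsin2 s'; rewrite cc; lra.
  rewrite mulf_eq0 subr_eq0 addr_eq0 => /orP[/eqP ss|/eqP ss].
    by exists t; rewrite -/(k t) tE /rotx cc ss.
  by exists (- t); rewrite -/(k (- t)) kN tE -rotxN /rotx cosN sinN cc ss opprK.
have sF : SO3 F := SO3_conj sE sP.
have [|FF _] := comm F sF; first by rewrite Fk kNpi.
have /eqP : (F ord0 ord0 - 1) * (F ord0 ord0 + 1) = 0 by move: FF; lra.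
rewrite mulf_eq0 subr_eq0 addr_eq0 => /orP[/eqP F00|/eqP//].
(* If F kept the orientation of the axis it would commute with [k (pi / 2)], which it also inverts;
   then [k pi] would be 1. *)
have [s _ FE] := rotx_exists sF F00.
have [s' kE] := kx (pi / 2).
exfalso; apply: h1; apply: (SO3_conj_inj sP); rewrite -/(k pi) SO3_conj1//.
have := Fk (pi / 2); rewrite kN kE -rotxN FE -!rotxD [- s' + s]addrC.
move=> /(congr1 (mulmx (rotx (s' - s)))).
rewrite -!rotxD (_ : s' - s + (s + s') = s' + s'); last by ring.
rewrite (_ : s' - s + (s - s') = 0); last by ring.
by rewrite rotx0 rotxD -kE -kD -splitr.
Qed.

End Circle.

(** * Invariant forms of bounded matrix groups *)

Section InvariantForm.
Variable R : realType.

(** The square of the Frobenius norm; it stays submultiplicative and avoids roots. *)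
Definition frob m n (A : 'M[R]_(m, n)) : R := \sum_i \sum_j A i j ^+ 2.

Definition qform n (X : 'M[R]_n) (v : 'cV[R]_n) : R := (v^T *m X *m v) 0 0.

Lemma Cauchy_Schwarz (I : finType) (a b : I -> R) :
  (\sum_k a k * b k) ^+ 2 <= (\sum_k a k ^+ 2) * (\sum_k b k ^+ 2).
Proof.
set C := \sum_k _ * _; set A := \sum_k a k ^+ 2; set B := \sum_k b k ^+ 2.
have B0 : 0 <= B by apply: sumr_ge0 => k _; apply: sqr_ge0.
have : 0 <= \sum_k (B * a k - C * b k) ^+ 2.
  by apply: sumr_ge0 => k _; apply: sqr_ge0.
have -> : \sum_k (B * a k - C * b k) ^+ 2 = B * (A * B - C ^+ 2).
  transitivity (\sum_k (B ^+ 2 * a k ^+ 2 + - (2 * B * C) * (a k * b k) +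
      C ^+ 2 * b k ^+ 2)); first by apply: eq_bigr => k _; ring.
  by rewrite !big_split /= -!mulr_sumr -/A -/B -/C; ring.
have [Be0 _|Bn0] := eqVneq B 0; last first.
  by rewrite pmulr_rge0 ?subr_ge0// lt_neqAle eq_sym Bn0.
have -> : C = 0; last by rewrite Be0 mulr0 expr0n.
rewrite /C big1// => k _; have /psumr_eq0P/(_ k isT) : B = 0 := Be0.
by move=> /(_ (fun j _ => sqr_ge0 (b j)))/eqP; rewrite sqrf_eq0 => /eqP ->;
  rewrite mulr0.
Qed.

Lemma frob_ge0 m n (A : 'M[R]_(m, n)) : 0 <= frob A.
Proof. by apply: sumr_ge0 => i _; apply: sumr_ge0 => j _; apply: sqr_ge0. Qed.

Lemma frob_entry m n (A : 'M[R]_(m, n)) i j : A i j ^+ 2 <= frob A.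
Proof.
rewrite /frob (bigD1 i)//= (bigD1 j)//= -addrA lerDl addr_ge0//.
  by apply: sumr_ge0 => ? _; apply: sqr_ge0.
by apply: sumr_ge0 => ? _; apply: sumr_ge0 => ? _; apply: sqr_ge0.
Qed.

Lemma frob_eq0 m n (A : 'M[R]_(m, n)) : frob A <= 0 -> A = 0.
Proof.
move=> A0; apply/matrixP => i j; rewrite mxE; apply/eqP; rewrite -sqrf_eq0.
by rewrite eq_le sqr_ge0 andbT (le_trans (frob_entry A i j)).
Qed.

Lemma frob_tr m n (A : 'M[R]_(m, n)) : frob A^T = frob A.
Proof.
rewrite /frob exchange_big /=; apply: eq_bigr => i _; apply: eq_bigr => j _.
by rewrite mxE.
Qed.

Lemma frob_mul m n p (A : 'M[R]_(m, n)) (B : 'M[R]_(n, p)) :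
  frob (A *m B) <= frob A * frob B.
Proof.
rewrite -[frob B]frob_tr /frob mulr_suml; apply: ler_sum => i _.
rewrite mulr_sumr; apply: ler_sum => j _; rewrite mxE.
under [X in _ <= _ * X]eq_bigr do rewrite mxE.
exact: Cauchy_Schwarz.
Qed.

(** The parallelogram law; its negative term is the uniform convexity behind the uniqueness of the
    minimising form. *)
Lemma frob_midpoint m n (A B : 'M[R]_(m, n)) : frob (2^-1 *: (A + B)) =
  2^-1 * (frob A + frob B) - 4^-1 * frob (A - B).
Proof.
rewrite /frob -big_split mulr_sumr mulr_sumr -sumrB; apply: eq_bigr => i _ /=.
rewrite -big_split mulr_sumr mulr_sumr -sumrB; apply: eq_bigr => j _ /=.
by rewrite !mxE; field.
Qed.

Lemma qform1 n (v : 'cV[R]_n) a : qform a%:M v = a * frob v.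
Proof.
rewrite /qform mul_mx_scalar -scalemxAl !mxE; congr (_ * _).
by apply: eq_bigr => i _; rewrite big_ord1 !mxE.
Qed.

Lemma qformD n (X Y : 'M[R]_n) v : qform (X + Y) v = qform X v + qform Y v.
Proof. by rewrite /qform mulmxDr mulmxDl mxE. Qed.

Lemma qformZ n a (X : 'M[R]_n) v : qform (a *: X) v = a * qform X v.
Proof. by rewrite /qform -scalemxAr -scalemxAl mxE. Qed.

Lemma qform_tr n (X : 'M[R]_n) v : qform X^T v = qform X v.
Proof.
have <- : (v^T *m X *m v)^T 0 0 = qform X v by rewrite mxE.
by rewrite !trmx_mul trmxK mulmxA.
Qed.

Lemma qform_mul n (X A : 'M[R]_n) v : qform X (A *m v) =
  qform (A^T *m X *m A) v.
Proof. by rewrite /qform trmx_mul !mulmxA. Qed.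

End InvariantForm.

(** * Existence of an invariant positive definite form *)

Section InvariantFormExists.
Variable R : realType.

Lemma mxcont_vec_mx m n : mxcont (fun x : 'rV[R]_(m * n) =>
  vec_mx x : 'M[R]_(m, n)).
Proof.
move=> i j; under [X in continuous X]eq_fun do rewrite mxE.
exact: coord_continuous.
Qed.

Lemma mxcont_frob (T : topologicalType) m n (F : T -> 'M[R]_(m, n)) :
  mxcont F -> continuous (fun t => frob (F t)).
Proof.
move=> cF; apply: (@continuous_big _ _ _ _ _ add_continuous) => i _.
apply: (@continuous_big _ _ _ _ _ add_continuous) => j _ t.
by apply: continuousM; apply: cF.
Qed.

Lemma closed_fun_ge (T : topologicalType) (f : T -> R) a :
  continuous f -> closed [set x | a <= f x].
Proof. by move=> cf; apply: (@preimage_closed _ _ f [set y | a <= y]) => //;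
  exact: closed_ge. Qed.

Lemma closed_fun_le (T : topologicalType) (f : T -> R) a :
  continuous f -> closed [set x | f x <= a].
Proof. by move=> cf; apply: (@preimage_closed _ _ f [set y | y <= a]) => //;
  exact: closed_le. Qed.

(* Among the forms bounded below along the group, take one that minimises the
   supremum of the Frobenius norm over its orbit. By uniform convexity this
   minimiser is unique, hence invariant. *)
Lemma invariant_form n (K : set 'M[R]_n) (d : R) :
  mx_group K -> 0 < d -> (forall A, K A -> frob A <= d) ->
  exists X : 'M[R]_n, [/\ X^T = X, forall v, v != 0 -> 0 < qform X v
    & forall A, K A -> A^T *m X *m A = X].
Proof.
move=> [K1 Ku KM KV] d0 dK.
have frobK p A (B : 'M[R]_(n, p)) : K A -> frob (A *m B) <= d * frob B.
  by move=> KA; apply: le_trans (frob_mul _ _) _;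
    rewrite ler_wpM2r ?frob_ge0 ?dK.
have frobKi p A (B : 'M[R]_(n, p)) : K A -> frob B <= d * frob (A *m B).
  by move=> KA; rewrite -{1}(mulKmx (Ku A KA) B); apply/frobK/KV.
have conjK A X : K A -> frob (A^T *m X *m A) <= d * (d * frob X).
  move=> KA; apply: le_trans (frob_mul _ _) _.
  rewrite mulrC ler_pM ?frob_ge0 ?dK//; apply: le_trans (frob_mul _ _) _.
  by rewrite frob_tr ler_wpM2r ?frob_ge0 ?dK.
have conjKi A X : K A -> frob X <= d * (d * frob (A^T *m X *m A)).
  move=> KA; have Au := Ku A KA.
  rewrite -{1}[X](_ : (invmx A)^T *m (A^T *m X *m A) *m invmx A = X).
    exact/conjK/KV.
  by rewrite !mulmxA -trmx_mul mulmxV// trmx1 mul1mx mulmxK.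
(* This lower bound along the group keeps forms positive definite. It is convex, closed, and
   invariant under the group. *)
pose V X := forall A v, K A -> frob v <= qform X (A *m v).
pose S r X := V X /\ forall A, K A -> frob (A^T *m X *m A) <= r.
pose E := [set r | exists X, S r X].
have E0 : E !=set0.
  (* The scalar form d satisfies [V], as inverses of elements of K are also bounded by d. *)
  exists (d * (d * frob (d%:M : 'M[R]_n))), d%:M; split=> A.
    by move=> v KA; rewrite qform1 frobKi.
  by move=> KA; apply: conjK.
have Elb : has_lbound E.
  exists 0 => r [X [_ /(_ 1%:M K1)]]; apply: le_trans; exact: frob_ge0.
pose m := inf E.
have mE r X : S r X -> m <= r by move=> SX; apply: ge_inf => //; exists X.
have Em e : 0 < e -> exists X, S (m + e) X.
  move=> e0; have [r [X [VX SX]] re] := inf_adherent e0 (conj E0 Elb).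
  by exists X; split=> // A KA; apply: le_trans (SX A KA) (ltW re).
have [X SX] : exists X, S m X.
  (* The near-minimisers form nested nonempty closed sets, one of them compact; a cluster point of
     the filter they generate attains the infimum. Row vectors are used because the compactness
     criterion is applied to them. *)
  pose B e := [set x : 'rV[R]_(n * n) | S (m + e) (vec_mx x)].
  have Bcl e : closed (B e).
    have -> : B e =
        (\bigcap_(A in K) \bigcap_(v in [set: 'cV[R]_n])
           [set x | frob v <= qform (vec_mx x) (A *m v)]) `&`
        (\bigcap_(A in K) [set x | frob (A^T *m vec_mx x *m A) <= m + e]).
      apply/seteqP; split=> x [VX nX]; split=> A.
      - by move=> KA v _; apply: VX.
      - exact: nX.
      - by move=> v KA; apply: VX.
      - exact: nX.
    apply: closedI; apply: closed_bigI => A _.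
      apply: closed_bigI => v _; apply: closed_fun_ge.
      have c1 := mxcont_mul (mxcont_cst (A *m v)^T) (@mxcont_vec_mx n n).
      exact: mxcont_mul c1 (mxcont_cst (A *m v)) 0 0.
    apply: closed_fun_le; apply: mxcont_frob.
    have c1 := mxcont_mul (mxcont_cst A^T) (@mxcont_vec_mx n n).
    exact: mxcont_mul c1 (mxcont_cst A).
  have Bc : compact (B 1).
    apply: bounded_closed_compact => //.
    exists (m + 2); split; first exact: num_real.
    move=> M Mm x [_ /(_ 1%:M K1)].
    rewrite trmx1 mul1mx mulmx1 => Sx.
    have m0 := le_trans (frob_ge0 _) Sx.
    rewrite /Num.norm /= mx_normrE; apply: bigmax_le => [|[i j] _ /=];
      first by lra.
    rewrite ord1; case/mxvec_indexP: j => a b.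
    have := le_trans (frob_entry _ a b) Sx.
    rewrite mxE -real_normK ?num_real//;
      have := normr_ge0 (x 0 (mxvec_index a b)).
    by move: `|_| => y; rewrite leNgt => *; apply/negP => ?; nra.
  pose F := filter_from [set e : R | 0 < e] B.
  have FF : ProperFilter F.
    apply: filter_from_proper => [|e /Em[X SX]]; last first.
      by exists (mxvec X); rewrite /B /= mxvecK.
    apply: filter_from_filter => [|e e' e0 e'0]; first by exists 1;
      rewrite /= ltr01.
    exists (Num.min e e'); first by rewrite /= lt_min e0.
    move=> x [VX nX]; split; split=> // A KA; apply: le_trans (nX A KA) _.
      by rewrite lerD2l ge_min lexx.
    by rewrite lerD2l ge_min lexx orbT.
  have [|x [Bx clx]] := Bc F FF; first by exists 1 => //; rewrite /= ltr01.
  have BX e : 0 < e -> B e x.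
    move=> e0; apply: Bcl; move: clx; rewrite clusterE; apply.
    by exists e.
  exists (vec_mx x); split; first by case: Bx.
  move=> A KA; apply/ler_addgt0Pr => e /BX[_]; exact.
have uniq Y : S m Y -> Y = X.
  move=> SY; have [VX nX] := SX; have [VY nY] := SY.
  (* The midpoint of two distinct minimisers would have a strictly smaller supremum over its
     orbit. *)
  pose Z : 'M[R]_n := 2^-1 *: (Y + X).
  have SZ : S (m - 4^-1 * (d^-1 * (d^-1 * frob (Y - X)))) Z.
    split=> [A v KA|A KA].
      rewrite qformZ qformD; have := VX A v KA; have := VY A v KA; lra.
    have -> : A^T *m Z *m A = 2^-1 *: (A^T *m Y *m A + A^T *m X *m A).
      by rewrite -scalemxAr -scalemxAl mulmxDr mulmxDl.
    rewrite frob_midpoint; have := nX A KA; have := nY A KA.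
    have := conjKi A (Y - X) KA; rewrite mulmxBr mulmxBl => YX.
    have : d^-1 * (d^-1 * frob (Y - X)) <= frob (A^T *m Y *m A - A^T *m X *m A).
      by rewrite -!ler_pdivlMl ?invr_gt0// invrK.
    lra.
  have := mE _ _ SZ; rewrite lerBrDl gerDr => YX.
  apply/eqP; rewrite -subr_eq0; apply/eqP/frob_eq0.
  by move: YX; rewrite pmulr_rle0 ?invr_gt0// !pmulr_rle0 ?invr_gt0.
have inv A : K A -> A^T *m X *m A = X.
  move=> KA; apply: uniq; have [VX nX] := SX; split=> [B v KB|B KB].
    by rewrite -qform_mul mulmxA; apply: VX; apply: KM.
  by have := nX _ (KM _ _ KA KB); rewrite trmx_mul !mulmxA.
(* The minimiser need not be symmetric; symmetrising preserves positivity and invariance. *)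
exists (X + X^T); split.
- by rewrite linearD /= trmxK addrC.
- move=> v v0; rewrite qformD qform_tr -mulr2n mulrn_wgt0//.
  have [VX _] := SX; have := VX 1%:M v K1; rewrite mul1mx; apply: lt_le_trans.
  rewrite lt_neqAle frob_ge0 andbT eq_sym; apply: contra_neq v0 => v0.
  by apply: frob_eq0; rewrite v0.
- move=> A KA; rewrite mulmxDr mulmxDl inv//; congr (_ + _).
  by rewrite -[in RHS](inv A KA) !trmx_mul trmxK mulmxA.
Qed.

End InvariantFormExists.

(** * Cholesky factorisation *)

Section Cholesky.
Variable R : realType.

Lemma qform_block n (a x : R) (b w : 'cV[R]_n) (D : 'M[R]_n) :
  qform (block_mx a%:M b^T b D) (col_mx (x%:M : 'M[R]_1) w) =
  a * x * x + 2 * x * (b^T *m w) 0 0 + qform D w.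
Proof.
rewrite /qform tr_col_mx mul_row_block mul_row_col.
have -> : w^T *m b = ((b^T *m w) 0 0)%:M.
  by rewrite -[LHS]trmxK trmx_mul trmxK {1}(mx11_scalar (b^T *m w))
    tr_scalar_mx.
rewrite tr_scalar_mx (mulmxDl _ _ w) (mul_scalar_mx x b^T) -scalemxAl.
move: (b^T *m w) (w^T *m D *m w) => u q.
by rewrite mulmxDl -!scalar_mxM !mxE eqxx /= !mulr1n; ring.
Qed.

(** The induction step applies to the Schur complement of a. Its value at w is that of the whole
    form at (x, w) with x = - (b^T w) / a, the x that minimises it, so it is positive definite. The
    factor is upper triangular with first row (s, b^T / s), where s is the root of a. *)
Lemma Cholesky_block n (a : R) (b : 'cV[R]_n) (D : 'M[R]_n) :
  (forall v, v != 0 -> 0 < qform (block_mx a%:M b^T b D) v) -> D^T = D ->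
  (forall X : 'M[R]_n, X^T = X -> (forall v, v != 0 -> 0 < qform X v) ->
     exists2 B : 'M[R]_n, B \in unitmx & B^T *m B = X) ->
  exists2 B : 'M[R]_(1 + n), B \in unitmx & B^T *m B = block_mx a%:M b^T b D.
Proof.
move=> posX symD IHn.
have neq0 (x : R) (w : 'cV[R]_n) : x != 0 \/ w != 0 ->
  col_mx (x%:M : 'M[R]_1) w != 0.
  move=> xw; apply/eqP => /eqP; rewrite col_mx_eq0 -scalemx1 scaler_eq0
    oner_eq0 orbF.
  by case: xw => /negPf->; rewrite ?andbF.
have a0 : 0 < a.
  have := posX _ (neq0 1 0 (or_introl (oner_neq0 R))).
  by rewrite qform_block /qform !mulmx0 !mxE !mulr1 mulr0 !addr0.
pose s := Num.sqrt a; have s0 : s != 0 by rewrite gt_eqF ?sqrtr_gt0.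
have ss : s * s = a by rewrite -expr2 sqr_sqrtr ?ltW.
have [||B Bu BE] := IHn (D - a^-1 *: (b *m b^T)).
- by rewrite linearB linearZ /= trmx_mul trmxK symD.
- move=> w w0; have := posX _ (neq0 (- a^-1 * (b^T *m w) 0 0) w (or_intror w0)).
  rewrite qform_block qformD -scaleNr qformZ.
  have -> : qform (b *m b^T) w = (b^T *m w) 0 0 * (b^T *m w) 0 0.
    rewrite /qform mulmxA -mulmxA [LHS]mxE big_ord1; congr (_ * _).
    by rewrite -[w^T *m b]trmxK trmx_mul trmxK mxE.
  congr (0 < _); field; exact: lt0r_neq0.
exists (block_mx (s%:M : 'M[R]_1) (s^-1 *: b^T) 0 B).
  rewrite unitmxE (det_ublock (s%:M : 'M[R]_1)) det_scalar1 unitrM -(unitmxE B)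
    Bu andbT.
  by rewrite unitfE.
rewrite tr_block_mx mulmx_block.
rewrite tr_scalar_mx trmx0 !mul0mx !mulmx0 !addr0 -scalar_mxM ss.
rewrite mul_scalar_mx scalerA divff// scale1r mul_mx_scalar linearZ /= trmxK
  scalerA divff// scale1r.
by rewrite -scalemxAl -scalemxAr scalerA -invfM ss BE addrC subrK.
Qed.

Lemma Cholesky n (X : 'M[R]_n) :
  X^T = X -> (forall v, v != 0 -> 0 < qform X v) ->
  exists2 B : 'M[R]_n, B \in unitmx & B^T *m B = X.
Proof.
elim: n X => [|n IHn] X symX posX.
  by exists 1%:M; [exact: unitmx1|rewrite [LHS]flatmx0 [RHS]flatmx0].
pose Y : 'M[R]_(1 + n) := X; have symY : Y^T = Y := symX.
have YE : Y = block_mx (ulsubmx Y 0 0)%:M (dlsubmx Y)^T (dlsubmx Y) (drsubmx Y).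
  by rewrite -mx11_scalar trmx_dlsub symY submxK.
have posY v : v != 0 -> 0 < qform Y v by exact: posX.
have symD : (drsubmx Y)^T = drsubmx Y by rewrite trmx_drsub symY.
rewrite YE in posY.
by have [B Bu BE] := Cholesky_block posY symD IHn; exists B; rewrite // BE -YE.
Qed.

End Cholesky.

(** * Continuous endomorphisms of SO(3) *)

Section SO3Onto.
Variable R : realType.
Implicit Types (A B P : 'M[R]_3) (s t : R).
Local Notation SO3 := (@special_orthogonal_group R 3).
Local Notation i1 := (@Ordinal 3 1 isT).
Local Notation i2 := (@Ordinal 3 2 isT).

Lemma plane_rotation (x y x' y' : R) : x * x + y * y = x' * x' + y' * y' ->
  exists s, cos s * x - sin s * y = x' /\ sin s * x + cos s * y = y'.
Proof.
move=> xy; have [r0|r0] := eqVneq (x * x + y * y) 0.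
  have [-> ->] := sqr_sum_eq0 r0; rewrite xy in r0.
  by have [-> ->] := sqr_sum_eq0 r0; exists 0; rewrite !mulr0 subr0 addr0.
pose r := x * x + y * y.
(* Cosine and sine of s are the real and imaginary parts of the quotient (x' + i y') / (x + i y). *)
have [|s _ [cE sE]] :=
  @angle_exists R ((x * x' + y * y') / r) ((x * y' - y * x') / r).
  transitivity (r * (x' * x' + y' * y') / (r * r));
    last by rewrite -xy -/r divff// mulf_neq0.
  by rewrite /r; field.
by exists s; rewrite -cE -sE; split; rewrite /r; field.
Qed.

Lemma roty_pi_rotx t : roty pi *m rotx t = rotx (- t) *m roty pi :> 'M[R]_3.
Proof. by rewrite roty_pi /rotx cosN sinN !m3_mul; congr m3; ring. Qed.

Lemma rotx_pi_neq1 : rotx pi <> 1%:M :> 'M[R]_3.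
Proof. by rewrite rotx_pi m3_1 => /m3_inj[_ [_ ? _] _]; lra. Qed.

Lemma rotx_2pi : rotx (pi + pi) = 1%:M :> 'M[R]_3.
Proof. by rewrite rotxD rotx_pi m3_mul m3_1; congr m3; ring. Qed.

(* The image of rotx is a full group of rotations about some axis, and
   that axis moves through all latitudes under the image of roty. *)
Lemma SO3_onto (rho : 'M[R]_3 -> 'M[R]_3) :
  (forall A, SO3 A -> SO3 (rho A)) ->
  (forall A B, SO3 A -> SO3 B -> rho (A *m B) = rho A *m rho B) ->
  rho (rotx pi) <> 1%:M ->
  mxcont (rho \o @rotx R) -> mxcont (rho \o @roty R) ->
  forall B, SO3 B -> exists2 A, SO3 A & rho A = B.
Proof.
move=> rS rM r1 cx cy B sB.
have rho1 : rho 1%:M = 1%:M.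
  apply: SO3_idem; first exact/rS/SO3_1.
  by rewrite -rM ?mul1mx//; apply: SO3_1.
have [|||||||P [sP Ponto PE]] :=
  circle_normal_form (h := rho \o @rotx R) (E := rho (roty pi)).
- by move=> t; apply/rS/SO3_rotx.
- by move=> s t /=; rewrite rotxD rM//; apply: SO3_rotx.
- exact: cx.
- by rewrite /= rotx_2pi.
- exact: r1.
- exact/rS/SO3_roty.
- move=> t /=; rewrite -!rM ?roty_pi_rotx//;
  do ?[exact: SO3_rotx|exact: SO3_roty].
pose k t := P^T *m rho (roty t) *m P; pose C := P^T *m B *m P.
have sC : SO3 C := SO3_conj sB sP.
have sk t : SO3 (k t) := SO3_conj (rS _ (SO3_roty t)) sP.
(* This entry of [k t] is 1 at 0 and, by [PE], -1 at pi. *)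
have [t kC] : exists t, k t ord0 ord0 = C ord0 ord0.
  have ck : mxcont k := mxcont_mul (mxcont_mul (mxcont_cst P^T) cy) (mxcont_cst
    P).
  have ck' : {within `[0, pi], continuous (fun t => k t ord0 ord0)}.
    by apply: continuous_subspaceT; exact: ck ord0 ord0.
  have [|t _ kt] := IVT (v := C ord0 ord0) (pi_ge0 R) ck'; last by exists t.
  have N11 : -1 <= 1 :> R by lra.
  have k0 : k 0 ord0 ord0 = 1 by rewrite /k roty0 rho1 SO3_conj1// mxE.
  have kpi : k pi ord0 ord0 = -1 by exact: PE.
  rewrite k0 kpi (min_r N11) (max_l N11).
  move: sC; have [a [b [c [d [e [f [g [h [i ->]]]]]]]]] := m3P C.
  by rewrite mxE /= => /SO3_m3[[? _ _] _ _ _]; apply/andP; split; nra.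
(* The first columns now have the same latitude, so a rotation about the first axis aligns them; the
   remaining discrepancy fixes the first basis vector. *)
have [s sE] : exists s, forall i, (rotx s *m k t) i ord0 = C i ord0.
  have := sk t; have := sC; move: kC.
  have [a [b [c [d [e [f [g [h [i ->]]]]]]]]] := m3P C.
  have [a' [b' [c' [d' [e' [f' [g' [h' [i' ->]]]]]]]]] := m3P (k t).
  rewrite !mxE /= => aa /SO3_m3[_ [c1 _ _] _ _] /SO3_m3[_ [c1' _ _] _ _].
  have [|s [s1 s2]] := @plane_rotation d' g' d g; first by rewrite aa in c1';
    lra.
  exists s => j; rewrite m3_mul !mxE.
  by case: (ord3_cases j) => -> /=; lra.
set M := rotx s *m k t in sE; have sM : SO3 M := SO3_mul (SO3_rotx s) (sk t).
have [|s' _ s'E] := rotx_exists (SO3_mul (SO3_tr sM) sC).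
  transitivity ((M^T *m M) ord0 ord0); last by rewrite SO3_trl// mxE.
  by rewrite !mxE; apply: eq_bigr => j _; rewrite sE.
have [u uE] := Ponto s; have [u' u'E] := Ponto s'.
exists (rotx u *m roty t *m rotx u').
  exact: SO3_mul (SO3_mul (SO3_rotx u) (SO3_roty t)) (SO3_rotx u').
apply: (SO3_conj_inj sP); rewrite -/C.
have -> : C = M *m rotx s' by rewrite -s'E mulmxA; case: sM => -> _;
  rewrite mul1mx.
have sut := SO3_mul (SO3_rotx u) (SO3_roty t).
rewrite /M -uE -u'E !rM//; do ?[exact: SO3_rotx|exact: SO3_roty].
by rewrite /k /= !SO3_conjM.
Qed.

End SO3Onto.

(** * Affine groups isomorphic to SO(3) *)

Section AffineSO3.
Variable R : realType.
Local Notation SO3 := (@special_orthogonal_group R 3).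
Implicit Types (A B G P : 'M[R]_3) (M : 'M[R]_4).

(** The affine maps fixing the origin; in quaternion coordinates, the maps that fix 1 and act
    linearly on the pure quaternions. *)
Definition emb A : 'M[R]_4 := block_mx (1%:M : 'M[R]_1) 0 0 A.

Lemma emb1 : emb 1%:M = 1%:M.
Proof. by symmetry; apply: (@scalar_mx_block R 1 3 1). Qed.

Lemma embM A B : emb (A *m B) = emb A *m emb B.
Proof. by rewrite /emb (@mulmx_block R 1 3 1 3 1 3) !mul0mx !mulmx0 mulmx1
  !addr0 add0r. Qed.

Lemma emb_inj A B : emb A = emb B -> A = B.
Proof. by move=> /(@eq_block_mx _ 1 3 1 3)[]. Qed.

Lemma emb_unit A : A \in unitmx -> emb A \in unitmx.
Proof. by move=> Au; rewrite unitmxE (@det_ublock R 1 3) det1 mul1r -unitmxE.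
  Qed.

Lemma SO3_unit A : SO3 A -> A \in unitmx.
Proof. by move=> [_ dA]; rewrite unitmxE dA unitr1. Qed.

(** By Euler angles a rotation is a product of three factors from two circles. The images of these
    circles are bounded by the extreme value theorem, and the norm is submultiplicative. *)
Lemma SO3_image_bounded (g : 'M[R]_3 -> 'M[R]_4) :
  (forall A B, SO3 A -> SO3 B -> g (A *m B) = g A *m g B) ->
  {within SO3, continuous g} ->
  exists2 d : R, 0 < d & forall A, SO3 A -> frob (g A) <= d.
Proof.
move=> gM cg.
have bd (F : R -> 'M[R]_3) : mxcont F -> (forall t, SO3 (F t)) ->
    exists2 d : R, 0 < d & forall t : R, t \in `[- pi, pi] ->
      frob (g (F t)) <= d.
  move=> cF SF; have cgF := mxcont_frob (mxcont_within cg cF SF).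
  have Npi : - pi <= pi :> R by have := pi_ge0 R; lra.
  have [c _ cP] := EVT_max Npi (continuous_subspaceT cgF).
  exists (frob (g (F c)) + 1); first by rewrite ltr_pwDr ?frob_ge0.
  by move=> t /cP /le_trans; apply; rewrite lerDl.
have [d1 d10 b1] := bd _ (@mxcont_rotx R) (@SO3_rotx R).
have [d2 d20 b2] := bd _ (@mxcont_rotz R) (@SO3_rotz R).
exists (d1 * d2 * d1) => [|A /Euler_decomposition[p [q [r [rI ->]]]]];
  first by rewrite !mulr_gt0.
have red (t : R) :
    exists2 t' : R, t' \in `[- pi, pi] & cos t = cos t' /\ sin t = sin t'.
  by apply: angle_exists; rewrite -!expr2 cos2Dsin2.
have [p' pI [cp sp]] := red p; have [q' qI [cq sq]] := red q.
have -> : rotx p = rotx p' by rewrite /rotx cp sp.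
have -> : rotz q = rotz q' by rewrite /rotz cq sq.
have sx := @SO3_rotx R; have sz := @SO3_rotz R.
rewrite !gM//; last exact: SO3_mul.
apply: le_trans (frob_mul _ _) _; rewrite ler_pM ?frob_ge0 ?b1//.
by apply: le_trans (frob_mul _ _) _; rewrite ler_pM ?frob_ge0 ?b1 ?b2.
Qed.

(* A bounded group of affine maps preserves a form X; the vector X^-1 e0, scaled
   to first coordinate 1, is a fixed point, and a Cholesky factor of the
   restriction of X to R^3 turns the linear parts into orthogonal maps. *)
Lemma bounded_affine_orthogonal (K : set 'M[R]_4) (d : R) :
  mx_group K -> K `<=` @affine_group3 R -> 0 < d ->
  (forall M, K M -> frob M <= d) ->
  exists2 T : 'M[R]_4, T \in unitmx & forall M, K M ->
    exists2 G, G *m G^T = 1%:M & T *m M = emb G *m T.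
Proof.
move=> gK Kaff d0 dK; have [X [symX posX invX]] := invariant_form gK d0 dK.
pose Y : 'M[R]_(1 + 3) := X; have symY : Y^T = Y := symX.
pose a : R := ulsubmx Y 0 0; pose b : 'cV[R]_3 := dlsubmx Y;
  pose D := drsubmx Y.
have YE : Y = block_mx a%:M b^T b D.
  by rewrite /a /b -mx11_scalar trmx_dlsub symY submxK.
have symD : D^T = D by rewrite trmx_drsub symY.
have posD w : w != 0 -> 0 < qform D w.
  move=> w0; have : 0 < qform Y (col_mx (0%:M : 'M[R]_1) w).
    by apply: posX; apply/eqP => /eqP;
      rewrite (@col_mx_eq0 _ 1 3 1) (negPf w0) andbF.
  by rewrite YE qform_block !mulr0 mul0r !add0r.
have [B Bu BE] := Cholesky symD posD.
have Du : D \in unitmx by rewrite -BE unitmx_mul unitmx_tr Bu.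
(* X maps (1, q) to a multiple of e0, so q will be the fixed point; T is the affine map x |-> B (x -
   q). *)
have [q Dq] : exists q, D *m q = - b.
  by exists (- (invmx D *m b)); rewrite mulmxN mulKVmx.
pose T : 'M[R]_4 := block_mx (1%:M : 'M[R]_1) 0 (- (B *m q)) B.
exists T; first by rewrite unitmxE (@det_lblock R 1 3) det1 mul1r -unitmxE.
move=> M KM; have [A [c [Au ME]]] := Kaff M KM.
have : (M^T *m X *m M) = Y :> 'M[R]_(1 + 3) := invX M KM.
rewrite ME {1}[X in _ *m X *m _](YE : X = _).
rewrite (@tr_block_mx R 1 3 1 3) (@mulmx_block R 1 3 1 3 1 3).
rewrite (@mulmx_block R 1 3 1 3 1 3) YE !trmx0 !mul0mx !mulmx0 !add0r !mulmx1.
move=> /(@eq_block_mx _ 1 3 1 3)[_ _ e21 e22].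
(* Cancel A^T D, using the lower blocks of the invariance equation. *)
have fixq : c + A *m q = q.
  have ADu : A^T *m D \in unitmx by rewrite unitmx_mul unitmx_tr Au.
  apply: (can_inj (mulKmx ADu)); rewrite mulmxDr mulmxA e22 Dq -[in LHS]e21.
  by rewrite opprD addrC addrNK -mulmxA Dq mulmxN.
exists (B *m A *m invmx B).
  apply: mulmx1C; rewrite !trmx_mul trmx_inv -!mulmxA (mulmxA B^T) BE.
  by rewrite (mulmxA A^T) (mulmxA _ A) e22 -BE mulmxK// mulVmx ?unitmx_tr.
rewrite /T /emb !(@mulmx_block R 1 3 1 3 1 3) !mul1mx !mul0mx !mulmx0 !addr0
  !add0r.
rewrite mulmx1 mulmxKV//; congr (@block_mx _ 1 3 1 3 _ _ _ _).
by rewrite mulmxN !mulmxA mulmxKV// -{1}fixq mulmxDr opprD addrAC addNr add0r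
  mulmxA.
Qed.

Lemma drsubmx_emb A : drsubmx (emb A : 'M[R]_(1 + 3)) = A.
Proof. exact: block_mxKdr. Qed.

(** An explicit formula, rather than a choice of the orthogonal part, makes continuity in M
    evident. *)
Definition linpart (T M : 'M[R]_4) : 'M[R]_3 :=
  drsubmx (T *m M *m invmx T : 'M[R]_(1 + 3)).

Lemma linpartE T M A : T \in unitmx -> T *m M = emb A *m T -> linpart T M = A.
Proof. by move=> Tu TM; rewrite /linpart TM mulmxK// drsubmx_emb. Qed.

Lemma mxcont_linpart T (F : R -> 'M[R]_4) : mxcont F -> mxcont (linpart T \o F).
Proof.
move=> cF i j; have cT := mxcont_mul (mxcont_mul (mxcont_cst T) cF) (mxcont_cst
  (invmx T)).
have -> : (fun t => (linpart T \o F) t i j) =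
    (fun t => (T *m F t *m invmx T) (@rshift 1 3 i) (@rshift 1 3 j)).
  by apply/funext => t; rewrite /linpart /= [LHS]mxE [LHS]mxE.
exact: cT.
Qed.

(** Boundedness conjugates Omega into O(3), so the inverse isomorphism becomes a homomorphism [rho]
    from SO(3) to O(3). Its values have determinant 1, and [SO3_onto] makes it surjective. *)
Lemma affine_SO3_normal_form (Omega : set 'M[R]_4) :
  mx_group Omega -> Omega `<=` @affine_group3 R -> top_group_iso Omega SO3 ->
  exists2 T : 'M[R]_4, T \in unitmx &
    (forall M, Omega M -> exists2 A, SO3 A & T *m M = emb A *m T) /\
    (forall A, SO3 A -> exists2 M, Omega M & T *m M = emb A *m T).
Proof.
move=> gO Oaff [f [g [[fO fi fs] gf fM _ cg]]].
have gS A : SO3 A -> Omega (g A) /\ f (g A) = A.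
  by move=> /fs[M OM <-]; rewrite gf.
have gM A B : SO3 A -> SO3 B -> g (A *m B) = g A *m g B.
  move=> /gS[OA fA] /gS[OB fB]; rewrite -{1}fA -{1}fB -fM// gf//.
  by case: gO => _ _ + _; apply.
have [d d0 dO] := SO3_image_bounded gM cg.
have [|T Tu TO] := bounded_affine_orthogonal gO Oaff d0.
  by move=> M OM; rewrite -(gf M OM); apply/dO/fO.
pose rho A := linpart T (g A).
have rhoEO A : SO3 A -> T *m g A = emb (rho A) *m T /\ rho A *m (rho A)^T =
  1%:M.
  by move=> /gS[/TO[G G1 GE] _]; rewrite /rho (linpartE Tu GE).
have rhoE A : SO3 A -> T *m g A = emb (rho A) *m T by move=> /rhoEO[].
have rhoO A : SO3 A -> rho A *m (rho A)^T = 1%:M by move=> /rhoEO[].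
have rhoM A B : SO3 A -> SO3 B -> rho (A *m B) = rho A *m rho B.
  move=> sA sB; apply: emb_inj; apply: (can_inj (mulmxK Tu)).
  by rewrite -rhoE ?gM ?embM ?mulmxA ?rhoE -?mulmxA ?rhoE//; apply: SO3_mul.
have det1 A : SO3 A -> \det (rho A) * \det (rho A) = 1.
  by move=> /rhoO /(congr1 determinant); rewrite det_mulmx det_tr det1.
(* Elements of a one-parameter group are squares, so a determinant of square 1 becomes 1. *)
have detr (F : R -> 'M[R]_3) : (forall t, SO3 (F t)) ->
    (forall s t, F (s + t) = F s *m F t) -> forall t, \det (rho (F t)) = 1.
  move=> SF FD t; have -> : t = t / 2 + t / 2 by field.
  by rewrite FD rhoM// det_mulmx det1.
have rhoS A : SO3 A -> SO3 (rho A).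
  move=> sA; split; first exact: rhoO.
  have [p [q [r [_ ->]]]] := Euler_decomposition sA.
  have sx := @SO3_rotx R; have sz := @SO3_rotz R.
  rewrite !rhoM//; last exact: SO3_mul.
  by rewrite !det_mulmx !(detr _ sx (@rotxD R)) (detr _ sz (@rotzD R)) !mulr1.
have crho (F : R -> 'M[R]_3) : mxcont F -> (forall t, SO3 (F t)) ->
  mxcont (rho \o F).
  by move=> cF SF; have cG := mxcont_within cg cF SF;
    exact: (@mxcont_linpart T _ cG).
have onto := SO3_onto rhoS rhoM _ (crho _ (@mxcont_rotx R) (@SO3_rotx R))
  (crho _ (@mxcont_roty R) (@SO3_roty R)).
exists T => //; split=> [M OM|A sA].
  exists (rho (f M)); first exact/rhoS/fO.
  by rewrite -rhoE ?gf//; apply: fO.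
have [|B sB BA] := onto _ A sA; last by exists (g B);
  [case: (gS B sB)|rewrite rhoE// BA].
have s1 := SO3_1 R; have spi := @SO3_rotx R pi.
have rho1 : rho 1%:M = 1%:M by apply: SO3_idem (rhoS _ s1) _;
  rewrite -rhoM ?mul1mx.
move=> rpi; apply: (@rotx_pi_neq1 R);
  rewrite -[LHS](proj2 (gS _ spi)) -[RHS](proj2 (gS _ s1)).
by congr f; apply: (can_inj (mulKmx Tu)); rewrite !rhoE// rpi rho1.
Qed.

End AffineSO3.

(** * Rotation invariant regular spreads *)

Section SpreadNormalForm.
Variable R : realType.
Local Notation SO3 := (@special_orthogonal_group R 3).
Implicit Types (L A B D T : pg_subspace R).

Definition v3 (y z t : R) : 'cV[R]_3 := \col_k [:: y; z; t]`_k.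

Lemma v4_col_mx (x y z t : R) :
  v4 x y z t = col_mx (x%:M : 'M[R]_1) (v3 y z t) :> 'cV[R]_(1 + 3).
Proof.
apply/colP => k; rewrite [LHS]mxE; case: (@split_ordP 1 3 k) => j ->.
  by rewrite col_mxEu ord1 mxE.
by rewrite col_mxEd [RHS]mxE.
Qed.

Lemma emb_v4 (a b c d e f g h i x y z t : R) :
  emb (m3 a b c d e f g h i) *m v4 x y z t =
  v4 x (a * y + b * z + c * t) (d * y + e * z + f * t) (g * y + h * z + i * t).
Proof.
rewrite !v4_col_mx /emb (@mul_block_col R 1 3 1 3 1) mul1mx !mul0mx addr0 add0r.
congr (@col_mx R 1 3 1 _ _); apply/colP => k;
  rewrite mxE !big_ord_recl big_ord0 !mxE.
by case: (ord3_cases k) => -> /=; rewrite addr0 addrA.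
Qed.

Definition scale0 (l : R) : 'M[R]_4 :=
  block_mx (l%:M : 'M[R]_1) 0 0 (1%:M : 'M[R]_3).

Lemma scale0_unit l : l != 0 -> scale0 l \in unitmx.
Proof.
move=> l0; rewrite unitmxE (@det_ublock R 1 3) det1 mulr1 det_scalar1.
by rewrite unitfE.
Qed.

Lemma scale0_emb l (A : 'M[R]_3) : scale0 l *m emb A = emb A *m scale0 l.
Proof.
rewrite /emb /scale0 !(@mulmx_block R 1 3 1 3 1 3) !mul0mx !mulmx0 !mul1mx
  !mulmx1.
by rewrite !addr0 !add0r.
Qed.

Lemma scale0_v4 (l x y z t : R) : scale0 l *m v4 x y z t = v4 (l * x) y z t.
Proof.
rewrite !v4_col_mx /scale0 (@mul_block_col R 1 3 1 3 1) mul1mx !mul0mx addr0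
  add0r.
by rewrite scalar_mxM.
Qed.

Lemma mem_v4_eq L (a b c d a' b' c' d' : R) : v4 a b c d \in L ->
  a = a' -> b = b' -> c = c' -> d = d' -> v4 a' b' c' d' \in L.
Proof. by move=> + <- <- <- <-. Qed.

(** The image of L is a line of C sharing the point M x with L, hence is L. *)
Lemma mx_act_fixed_line (C : set (pg_subspace R)) M L x :
  regular_spread C -> (forall L, C L -> C (mx_act M L)) ->
  C L -> x != 0 -> x \in L -> M *m x \in L -> M *m x != 0 ->
  forall y, y \in L -> M *m y \in L.
Proof.
move=> [_ _ Cun _] CM CL x0 xL MxL Mx0 y yL.
rewrite -(Cun (mx_act M L) L (M *m x)) ?mem_mx_act//; exact: CM.
Qed.

Lemma v4_neq0 (a b c d : R) : [|| a != 0, b != 0, c != 0 | d != 0] ->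
  v4 a b c d != 0.
Proof. by apply: contraTneq => /v4_eq0[-> -> -> ->]; rewrite eqxx. Qed.

Lemma rotx_v4 (s x y z t : R) : emb (rotx s) *m v4 x y z t =
  v4 x y (cos s * z - sin s * t) (sin s * z + cos s * t).
Proof. by rewrite emb_v4; congr v4; ring. Qed.

Lemma rotx_pi_v4 (x y z t : R) : emb (rotx pi) *m v4 x y z t =
  v4 x y (- z) (- t).
Proof. by rewrite rotx_v4 cospi sinpi; congr v4; ring. Qed.

Lemma roty_pi_v4 (x y z t : R) : emb (roty pi) *m v4 x y z t =
  v4 x (- y) z (- t).
Proof. by rewrite emb_v4 cospi sinpi; congr v4; ring. Qed.

(* The lines <(1, 0, p, q), (0, 1, q, -p)>, p and q real, together with
   <(0, 0, 1, 0), (0, 0, 0, 1)>, are the planes qK with K = <1, i> and q a nonzero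
   quaternion. *)
Definition hopf_line (p q : R) : pg_subspace R :=
  pline (v4 1 0 p q) (v4 0 1 q (- p)).
Definition hopf_infty : pg_subspace R := pline (v4 0 0 1 0) (v4 0 0 0 1).

Lemma indep2_hopf p q : indep2 (@v4 R 1 0 p q) (v4 0 1 q (- p)).
Proof.
move=> a b; rewrite !v4Z v4D => /v4_eq0[e1 e2 _ _].
by move: e1 e2; rewrite !mulr1 !mulr0 addr0 add0r.
Qed.

Lemma indep2_hopf_infty : indep2 (@v4 R 0 0 1 0) (v4 0 0 0 1).
Proof.
move=> a b; rewrite !v4Z v4D => /v4_eq0[_ _ e1 e2].
by move: e1 e2; rewrite !mulr1 !mulr0 addr0 add0r.
Qed.

Lemma mem_hopf_line (p q a b c d : R) : (v4 a b c d \in hopf_line p q) =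
  (c == a * p + b * q) && (d == a * q - b * p).
Proof.
apply/idP/andP => [/plineP[s [t]]|[/eqP-> /eqP->]].
  rewrite !v4Z v4D => /v4_inj[-> -> -> ->].
  by split; apply/eqP; ring.
have -> : v4 a b (a * p + b * q) (a * q - b * p) = a *: v4 1 0 p q +
  b *: v4 0 1 q (- p).
  by rewrite !v4Z v4D; congr v4; ring.
exact: mem_pline.
Qed.

Lemma mem_hopf_infty (a b c d : R) : (v4 a b c d \in hopf_infty) =
  (a == 0) && (b == 0).
Proof.
apply/idP/andP => [/plineP[s [t]]|[/eqP-> /eqP->]].
  by rewrite !v4Z v4D => /v4_inj[-> -> _ _]; rewrite !mulr0 addr0.
have -> : v4 0 0 c d = c *: v4 0 0 1 0 + d *: v4 0 0 0 1.
  by rewrite !v4Z v4D; congr v4; ring.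
exact: mem_pline.
Qed.

(** Take the lines of C through (1,0,0,0), (0,0,1,0) and (1,0,1,0). Each of these points is fixed by
    suitable rotations, which therefore preserve the line; half sums and half differences of a
    vector and its image split it into eigenvectors within the line. *)
Lemma rotation_invariant_spread (C : set (pg_subspace R)) :
  regular_spread C ->
  (forall s L, C L -> C (mx_act (emb (rotx s)) L)) ->
  (forall L, C L -> C (mx_act (emb (roty pi)) L)) ->
  [/\ C (hopf_line 0 0), C hopf_infty &
      exists2 g, g != 0 & C (pline (v4 1 0 1 0) (v4 0 1 0 g))].
Proof.
move=> rC Cx Cy; have [CL Cex Cun _] := rC.
have e00 : @v4 R 1 0 0 0 != 0 by apply: v4_neq0; rewrite oner_eq0.
have e20 : @v4 R 0 0 1 0 != 0 by apply: v4_neq0; rewrite oner_eq0 !orbT.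
have u0 : @v4 R 1 0 1 0 != 0 by apply: v4_neq0; rewrite oner_eq0.
have [L0 C0 e0L] := Cex _ e00; have [L2 C2 e2L] := Cex _ e20;
  have [L3 C3 uL] := Cex _ u0.
have L0E : L0 = hopf_line 0 0.
  have Rx0 s x : x \in L0 -> emb (rotx s) *m x \in L0.
    have fix0 : emb (rotx s) *m v4 1 0 0 0 = v4 1 0 0 0.
      by rewrite rotx_v4; congr v4; ring.
    by apply: (mx_act_fixed_line rC (Cx s) C0 e00 e0L); rewrite fix0.
  have [w ind LE] := line_basis (CL _ C0) e00 e0L.
  have wL : w \in L0 by rewrite LE mem_pliner.
  have [w0 [w1 [w2 [w3 wE]]]] := v4P w; rewrite {}wE in ind LE wL.
  have yL : v4 0 0 w2 w3 \in L0.
    have := memvZ 2^-1 (memvB wL (Rx0 pi _ wL));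
      rewrite rotx_pi_v4 -scaleN1r v4Z v4D v4Z.
    by move/mem_v4_eq; apply; field.
  (* Otherwise L0 is spanned by e0 and (0, 0, w2, w3), and a quarter turn moves the latter out of
     L0. *)
  have w230 : w2 * w2 + w3 * w3 = 0.
    have [/v4_eq0[_ _ -> ->]|y0] := eqVneq (v4 0 0 w2 w3) 0;
      first by rewrite !mulr0 addr0.
    have ind' : indep2 (v4 1 0 0 0) (v4 0 0 w2 w3).
      move=> a b; rewrite !v4Z v4D => /v4_eq0[];
        rewrite !mulr1 !mulr0 !addr0 !add0r.
      move=> -> _ e2 e3; split=> //; apply/eqP; apply: contraNT y0 => b0;
        apply/eqP.
      move/eqP: e2; rewrite mulf_eq0 (negPf b0) /= => /eqP ->.
      by move/eqP: e3; rewrite mulf_eq0 (negPf b0) /= => /eqP ->; rewrite v4_0.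
    have := Rx0 (pi / 2) _ yL; rewrite (pline_eq (CL _ C0) e0L yL ind') rotx_v4
      cos_pihalf sin_pihalf.
    move=> /plineP[a [b]]; rewrite !v4Z v4D => /v4_inj[_ _ e2 e3].
    have {}e2 : w3 = - (b * w2) by lra.
    have {}e3 : w2 = b * w3 by lra.
    by rewrite {1}e3 {2}e2; ring.
  have [w20 w30] := sqr_sum_eq0 w230; rewrite w20 w30 in ind LE wL.
  have w10 : w1 != 0.
    apply/eqP => w10; have [] := ind w0 (-1).
      by rewrite !v4Z v4D w10 -v4_0; congr v4; ring.
    by move=> _ /eqP; rewrite oppr_eq0 oner_eq0.
  apply: (pline_eq (CL _ C0) e0L _ (@indep2_hopf 0 0)).
  have := memvZ w1^-1 (memvB wL (memvZ w0 e0L)); rewrite -scaleN1r !v4Z v4D v4Z.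
  by move/mem_v4_eq; apply; field.
have L2E : L2 = hopf_infty.
  have Rx2 x : x \in L2 -> emb (rotx pi) *m x \in L2.
    have fix2 : emb (rotx pi) *m @v4 R 0 0 1 0 = - v4 0 0 1 0.
      by rewrite rotx_pi_v4 -[RHS]scaleN1r v4Z; congr v4; ring.
    by apply: (mx_act_fixed_line rC (Cx pi) C2 e20 e2L);
      rewrite fix2 ?rpredN ?oppr_eq0.
  have [w ind LE] := line_basis (CL _ C2) e20 e2L.
  have wL : w \in L2 by rewrite LE mem_pliner.
  have [w0 [w1 [w2 [w3 wE]]]] := v4P w; rewrite {}wE in ind LE wL.
  have yL : v4 w0 w1 0 0 \in L2.
    have := memvZ 2^-1 (memvD wL (Rx2 _ wL)); rewrite rotx_pi_v4 v4D v4Z.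
    by move/mem_v4_eq; apply; field.
  (* A nonzero (w0, w1, 0, 0) would be common to L2 and L0. *)
  have [/v4_eq0[w00 w10 _ _]|y0] := eqVneq (v4 w0 w1 0 0) 0; last first.
    have e : L2 = L0.
      by apply: (Cun _ _ _ C2 C0 y0 yL);
        rewrite L0E mem_hopf_line !mulr0 subr0 addr0 eqxx.
    by move: e2L; rewrite e L0E mem_hopf_line !mulr0 addr0 oner_eq0.
  rewrite w00 w10 in ind LE wL.
  have w30 : w3 != 0.
    apply/eqP => w30; have [] := ind w2 (-1).
      by rewrite !v4Z v4D w30 -v4_0; congr v4; ring.
    by move=> _ /eqP; rewrite oppr_eq0 oner_eq0.
  apply: (pline_eq (CL _ C2) e2L _ indep2_hopf_infty).
  have := memvZ w3^-1 (memvB wL (memvZ w2 e2L)); rewrite -scaleN1r !v4Z v4D v4Z.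
  by move/mem_v4_eq; apply; field.
have L30 x : x != 0 -> x \in L3 -> x \notin L0.
  move=> x0 x3; apply/negP => xL; have e : L3 = L0 by exact: Cun x0 x3 xL.
  by move: uL; rewrite e L0E mem_hopf_line !mulr0 addr0 oner_eq0.
have L32 x : x != 0 -> x \in L3 -> x \notin L2.
  move=> x0 x3; apply/negP => xL; have e : L3 = L2 by exact: Cun x0 x3 xL.
  by move: uL; rewrite e L2E mem_hopf_infty oner_eq0.
rewrite -L0E -L2E; split => //.
have Ry x : x \in L3 -> emb (roty pi) *m x \in L3.
  have fixu : emb (roty pi) *m @v4 R 1 0 1 0 = v4 1 0 1 0.
    by rewrite roty_pi_v4 oppr0.
  by apply: (mx_act_fixed_line rC Cy C3 u0 uL); rewrite fixu.
have [w ind LE] := line_basis (CL _ C3) u0 uL.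
have wL : w \in L3 by rewrite LE mem_pliner.
have [w0 [w1 [w2 [w3 wE]]]] := v4P w; rewrite {}wE in ind LE wL.
have yL : v4 0 w1 0 w3 \in L3.
  have := memvZ 2^-1 (memvB wL (Ry _ wL));
    rewrite roty_pi_v4 -scaleN1r v4Z v4D v4Z.
  by move/mem_v4_eq; apply; field.
have zL : v4 (w0 - w2) 0 0 0 \in L3.
  have := memvD (memvD wL (memvZ (-1) yL)) (memvZ (- w2) uL); rewrite !v4Z !v4D.
  by move/mem_v4_eq; apply; ring.
have w02 : w0 = w2.
  apply/eqP; rewrite -subr_eq0; apply/negPn/negP => d0.
  have := L30 _ _ zL; rewrite L0E mem_hopf_line !mulr0 ?mul0r subr0 addr0 eqxx
    => /(_ _)/negP; apply => //.
  by apply: v4_neq0; rewrite d0.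
have y0 : v4 0 w1 0 w3 != 0.
  apply/eqP => /v4_eq0[_ w10 _ w30]; have [] := ind w0 (-1).
    by rewrite !v4Z v4D w10 w30 w02 -v4_0; congr v4; ring.
  by move=> _ /eqP; rewrite oppr_eq0 oner_eq0.
(* Disjointness of L3 from L0 gives w3 != 0, and disjointness from L2 gives w1 != 0. *)
have := L30 _ y0 yL; rewrite L0E mem_hopf_line !mulr0 ?mul0r subr0 addr0 eqxx
  => w30.
have := L32 _ y0 yL; rewrite L2E mem_hopf_infty eqxx => w10.
exists (w3 / w1); first by rewrite mulf_neq0 ?invr_eq0.
rewrite -(pline_eq (CL _ C3) uL)//.
  have := memvZ w1^-1 yL; rewrite v4Z.
  by move/mem_v4_eq; apply; field.
move=> a b; rewrite !v4Z v4D => /v4_eq0[]; rewrite !mulr1 !mulr0 !addr0 !add0r.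
by move=> -> ->.
Qed.

End SpreadNormalForm.

(** * Identification of the spread with a Clifford class *)

Section Clifford.
Variable R : realType.
Local Notation SO3 := (@special_orthogonal_group R 3).
Implicit Types (L : pg_subspace R) (S : set (pg_subspace R)).

(** A common transversal is spanned by its points (x1, x2, 0, 0) and (0, 0, y3, y4), so it is
    invariant under scaling the last two coordinates. The factor r / p takes its point on
    [hopf_line p 0] to one on [hopf_line r 0]. *)
Lemma hopf_regulus S p r : regular_spread S -> S (hopf_line 0 0) ->
  S (hopf_infty R) ->
  p != 0 -> S (hopf_line p 0) -> S (hopf_line r 0).
Proof.
move=> [_ _ _ Sreg] S0 Si p0 Sp.
apply: (Sreg _ _ _ _ S0 Si Sp).
- apply/eqP => e; have := mem_plinel (@v4 R 1 0 0 0) (v4 0 1 0 (- 0)).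
  by rewrite -/(hopf_line 0 0) e mem_hopf_infty oner_eq0.
- apply/eqP => e; have := mem_plinel (@v4 R 1 0 p 0) (v4 0 1 0 (- p)).
  by rewrite -/(hopf_line p 0) -e mem_hopf_line mul1r !mulr0 addr0 (negPf p0).
- apply/eqP => e; have := mem_plinel (@v4 R 1 0 p 0) (v4 0 1 0 (- p)).
  by rewrite -/(hopf_line p 0) -e mem_hopf_infty oner_eq0.
- exact/dim_pline/indep2_hopf.
move=> T T2 [x [x0 xT xL]] [y [y0 yT yL]] [z [z0 zT zL]].
have [x1 [x2 [x3 [x4 xE]]]] := v4P x; have [y1 [y2 [y3 [y4 yE]]]] := v4P y.
have [z1 [z2 [z3 [z4 zE]]]] := v4P z;
  rewrite {}xE {}yE {}zE in x0 xT xL y0 yT yL z0 zT zL.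
move: xL yL zL; rewrite !mem_hopf_line mem_hopf_infty !mulr0 add0r subr0 addr0.
move=> /andP[/eqP x30 /eqP x40] /andP[/eqP y10 /eqP y20] /andP[/eqP z3E /eqP
  z4E].
rewrite {}x30 {}x40 {}y10 {}y20 {}z3E {}z4E in x0 xT y0 yT z0 zT.
have xy : indep2 (v4 x1 x2 0 0) (v4 0 0 y3 y4).
  move=> a b; rewrite !v4Z v4D => /v4_eq0[];
    rewrite !mulr0 !addr0 !add0r => e1 e2 e3 e4.
  split; apply/eqP.
    have : a *: v4 x1 x2 0 0 = 0 by rewrite v4Z e1 e2 !mulr0 v4_0.
    by move=> /eqP; rewrite scaler_eq0 (negPf x0) orbF.
  have : b *: v4 0 0 y3 y4 = 0 by rewrite v4Z e3 e4 !mulr0 v4_0.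
  by move=> /eqP; rewrite scaler_eq0 (negPf y0) orbF.
move: zT; rewrite (pline_eq T2 xT yT xy) => /plineP[a [b]].
rewrite !v4Z v4D !mulr0 !addr0 !add0r => /v4_inj[z1E z2E z3E z4E].
have zE : v4 z1 z2 (r * z1) (- (r * z2)) =
    a *: v4 x1 x2 0 0 + (r / p * b) *: v4 0 0 y3 y4.
  rewrite !v4Z v4D z1E z2E; congr v4;
    rewrite ?mulr0 ?addr0 ?add0r -?mulrA -?z3E -?z4E.
  - by field.
  - by field.
  - by rewrite z1E; field.
  - by rewrite z2E; field.
exists (v4 z1 z2 (r * z1) (- (r * z2))); split.
- apply: contraNneq z0 => /v4_eq0[-> -> _ _]; apply/eqP; rewrite -v4_0;
  congr v4; ring.
- by rewrite zE mem_pline.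
- by rewrite mem_hopf_line; apply/andP; split; apply/eqP; ring.
Qed.

(** With (p, q) = n (cos s, sin s), the rotation [rotx s] takes [hopf_line n 0] to
    [hopf_line p q]. *)
Lemma hopf_rotate S : regular_spread S -> S (hopf_line 0 0) ->
  (forall r, S (hopf_line r 0)) ->
  (forall s L, S L -> S (mx_act (emb (rotx s)) L)) ->
  forall p q, S (hopf_line p q).
Proof.
move=> rS S0 Sr Sx p q.
have [|s [pE qE]] := @plane_rotation R (Num.sqrt (p * p + q * q)) 0 p q.
  by rewrite mulr0 addr0 -expr2 sqr_sqrtr// -!expr2 addr_ge0 ?sqr_ge0.
move: (Num.sqrt _) pE qE => n pE qE; have := Sx s _ (Sr n).
rewrite mx_act_pline !rotx_v4; congr (S (pline (v4 _ _ _ _) (v4 _ _ _ _))).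
all: by lra.
Qed.

Lemma qmul_v4 (a b c d a' b' c' d' : R) : qmul (v4 a b c d) (v4 a' b' c' d') =
  v4 (a * a' - b * b' - c * c' - d * d') (a * b' + b * a' + c * d' - d * c')
     (a * c' - b * d' + c * a' + d * b') (a * d' + b * c' - c * b' + d * a').
Proof. by rewrite /qmul !coord4E. Qed.

Lemma qnorm_v4 (a b c d : R) : qnorm (v4 a b c d) = Num.sqrt (a * a +
  b * b + c * c + d * d).
Proof.
rewrite /qnorm !big_ord_recl big_ord0 !mxE /= !expr2 addr0 !addrA.
by [].
Qed.

Lemma qnorm1P (a b c d : R) : qnorm (v4 a b c d) = 1 <-> a * a + b * b +
  c * c + d * d = 1.
Proof.
rewrite qnorm_v4; split=> [|->]; last exact: sqrtr1.
by move=> /(congr1 (fun x => x ^+ 2));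
  rewrite sqr_sqrtr ?expr1n// -!expr2 !addr_ge0 ?sqr_ge0.
Qed.

Lemma qnorm_normalize (x : 'cV[R]_4) : x != 0 ->
  exists2 k, k != 0 & qnorm (k *: x) = 1.
Proof.
have [a [b [c [d ->]]]] := v4P x => x0.
have n0 : a * a + b * b + c * c + d * d != 0.
  rewrite -!expr2; apply: contraNneq x0 => /eqP.
  rewrite !paddr_eq0 ?addr_ge0 ?sqr_ge0// !sqrf_eq0.
  by case/andP=> /andP[/andP[/eqP-> /eqP->] /eqP->] /eqP->; rewrite v4_0.
pose n := Num.sqrt (a * a + b * b + c * c + d * d).
have nn : n * n = a * a + b * b + c * c + d * d.
  by rewrite -expr2 sqr_sqrtr// -!expr2 !addr_ge0 ?sqr_ge0.
have nn0 : n != 0 by apply: contraNneq n0 => n0; rewrite -nn n0 mulr0.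
exists n^-1; rewrite ?invr_eq0// v4Z; apply/qnorm1P.
transitivity (n^-1 * n^-1 * (n * n)); first by rewrite nn; ring.
by field.
Qed.

Definition right_line (a : 'cV[R]_4) := pline a (qmul a (v4 0 1 0 0)).

Lemma indep2_right_line (a : 'cV[R]_4) : qnorm a = 1 ->
  indep2 a (qmul a (v4 0 1 0 0)).
Proof.
have [a0 [a1 [a2 [a3 ->]]]] := v4P a => /qnorm1P n1 s t.
rewrite qmul_v4 !v4Z v4D => /v4_eq0[e0 e1 e2 e3].
have {}e0 : s * a0 - t * a1 = 0 by lra.
have {}e1 : s * a1 + t * a0 = 0 by lra.
have {}e2 : s * a2 + t * a3 = 0 by lra.
have {}e3 : s * a3 - t * a2 = 0 by lra.
split.
  (* Multiplying a (s + t i) = 0 on the left by the conjugate of a gives |a|^2 (s + t i) = 0; the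
     two computations are its real and i components. *)
  transitivity (s * (a0 * a0 + a1 * a1 + a2 * a2 + a3 * a3));
    first by rewrite n1 mulr1.
  transitivity (a0 * (s * a0 - t * a1) + a1 * (s * a1 + t * a0) +
      a2 * (s * a2 + t * a3) + a3 * (s * a3 - t * a2)); first by ring.
  by rewrite e0 e1 e2 e3; ring.
transitivity (t * (a0 * a0 + a1 * a1 + a2 * a2 + a3 * a3));
  first by rewrite n1 mulr1.
transitivity (a0 * (s * a1 + t * a0) - a1 * (s * a0 - t * a1) +
    a3 * (s * a2 + t * a3) - a2 * (s * a3 - t * a2)); first by ring.
by rewrite e0 e1 e2 e3; ring.
Qed.

Lemma clifford_class_hopf : clifford_class (hopf_line 0 0) =
  [set right_line a | a in [set a | qnorm a = 1]].
Proof.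
rewrite /clifford_class; apply: eq_imagel => a _.
rewrite limgD !limg_line !lfunE /= /right_line.
have [a0 [a1 [a2 [a3 ->]]]] := v4P a.
by rewrite !qmul_v4; congr pline; congr v4; ring.
Qed.

Lemma right_line_hopf S a : (forall p q, S (hopf_line p q)) ->
  S (hopf_infty R) ->
  qnorm a = 1 -> S (right_line a).
Proof.
move=> Sh Si; have [a0 [a1 [a2 [a3 ->]]]] := v4P a => n1.
have ind := indep2_right_line n1; rewrite /right_line.
have [n0|n0] := eqVneq (a0 * a0 + a1 * a1) 0.
  have [a00 a10] := sqr_sum_eq0 n0.
  rewrite -(pline_eq (dim_pline (@indep2_hopf_infty R)) _ _ ind)//.
    by rewrite -/(hopf_infty R) mem_hopf_infty a00 a10 eqxx.
  rewrite qmul_v4 -/(hopf_infty R) mem_hopf_infty a00 a10.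
  by apply/andP; split; apply/eqP; ring.
(* The solution of the linear equations saying that a lies on [hopf_line p q]. *)
pose p := (a0 * a2 - a1 * a3) / (a0 * a0 + a1 * a1).
pose q := (a1 * a2 + a0 * a3) / (a0 * a0 + a1 * a1).
have pq2 : a2 = a0 * p + a1 * q by rewrite /p /q; field.
have pq3 : a3 = a0 * q - a1 * p by rewrite /p /q; field.
rewrite -(pline_eq (dim_pline (@indep2_hopf R p q)) _ _ ind)//.
- exact: Sh.
- by rewrite -/(hopf_line p q) mem_hopf_line -pq2 -pq3 !eqxx.
- rewrite qmul_v4 -/(hopf_line p q) mem_hopf_line.
  by apply/andP; split; apply/eqP; rewrite pq2 pq3; ring.
Qed.

(** The planes aK belong to S and cover all points, so S has no other lines. *)
Lemma clifford_class_spread S : regular_spread S ->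
  (forall p q, S (hopf_line p q)) -> S (hopf_infty R) ->
  S = clifford_class (hopf_line 0 0).
Proof.
move=> [SL _ Sun _] Sh Si; rewrite clifford_class_hopf; apply/seteqP; split=> L.
  move=> SL'; have [x x0 xL] := line_neq0 (SL _ SL').
  have [k k0 kx] := qnorm_normalize x0; exists (k *: x) => //.
  apply: (Sun _ _ (k *: x)); [exact: right_line_hopf|by []|
    by rewrite scaler_eq0 negb_or k0|exact: mem_plinel|exact: memvZ].
by move=> [a /= a1 <-]; apply: right_line_hopf.
Qed.

Lemma rotation_invariant_spread_clifford (C : set (pg_subspace R)) :
  regular_spread C ->
  (forall s L, C L -> C (mx_act (emb (rotx s)) L)) ->
  (forall L, C L -> C (mx_act (emb (roty pi)) L)) ->
  exists2 l, l != 0 & mx_act (scale0 l) @` C = clifford_class (hopf_line 0 0).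
Proof.
move=> rC Cx Cy; have [C0 Ci [g g0 Cg]] := rotation_invariant_spread rC Cx Cy.
(* The third line is sent to the span of (l, 0, 1, 0) and (0, 1, 0, g), which is [hopf_line p 0]
   exactly when l p = 1 and g = - p. *)
pose l := - g^-1; have l0 : l != 0 by rewrite oppr_eq0 invr_eq0.
exists l => //; set S := _ @` _.
have rS : regular_spread S.
  exact: collineation_regular (mx_act_collineation (scale0_unit l0)) rC.
have [SL _ _ _] := rS.
have S0 : S (hopf_line 0 0).
  exists (hopf_line 0 0) => //; rewrite mx_act_pline !scale0_v4 mulr0 mulr1.
  apply/esym/pline_eq; [exact/dim_pline/indep2_hopf| | |].
  - by rewrite -/(hopf_line 0 0) mem_hopf_line; apply/andP; split; apply/eqP;
    ring.
  - exact: mem_pliner.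
  move=> a b; rewrite !v4Z v4D => /v4_eq0[]; rewrite !mulr0 !addr0 !add0r mulr1.
  by move=> /eqP; rewrite mulf_eq0 (negPf l0) orbF => /eqP.
have Si : S (hopf_infty R).
  by exists (hopf_infty R) => //; rewrite mx_act_pline !scale0_v4 mulr0.
have Sg : S (hopf_line (- g) 0).
  exists (pline (v4 1 0 1 0) (v4 0 1 0 g)) => //;
    rewrite mx_act_pline !scale0_v4 mulr0 mulr1.
  apply/esym/pline_eq; [exact/dim_pline/indep2_hopf| | |].
  - rewrite -/(hopf_line (- g) 0) mem_hopf_line /l.
    by apply/andP; split; apply/eqP; field.
  - by rewrite -/(hopf_line (- g) 0) mem_hopf_line; apply/andP; split;
    apply/eqP; ring.
  move=> a b; rewrite !v4Z v4D => /v4_eq0[];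
    rewrite !mulr0 !addr0 !add0r !mulr1.
  by move=> /eqP; rewrite mulf_eq0 (negPf l0) orbF => /eqP -> ->.
have Sr r : S (hopf_line r 0).
  by apply: (hopf_regulus r rS S0 Si _ Sg); rewrite oppr_eq0.
apply: clifford_class_spread => //; apply: hopf_rotate => //.
move=> s _ [L CL <-]; exists (mx_act (emb (rotx s)) L); first exact: Cx.
by rewrite -!mx_actM scale0_emb.
Qed.

End Clifford.

(** * The Clifford parallelism *)

Section Quaternions.
Variable R : realType.
Local Notation SO3 := (@special_orthogonal_group R 3).
Implicit Types (L : pg_subspace R) (A : 'M[R]_3) (a b x : 'cV[R]_4).
Local Notation C0 := (@hopf_line R 0 0).

Lemma qmulA a b x : qmul a (qmul b x) = qmul (qmul a b) x.
Proof.
have [a0 [a1 [a2 [a3 ->]]]] := v4P a; have [b0 [b1 [b2 [b3 ->]]]] := v4P b.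
have [x0 [x1 [x2 [x3 ->]]]] := v4P x.
by rewrite !qmul_v4; congr v4; ring.
Qed.

Lemma qmul1q x : qmul (v4 1 0 0 0) x = x.
Proof. by have [x0 [x1 [x2 [x3 ->]]]] := v4P x; rewrite qmul_v4; congr v4;
  ring. Qed.

Lemma qmulq1 x : qmul x (v4 1 0 0 0) = x.
Proof. by have [x0 [x1 [x2 [x3 ->]]]] := v4P x; rewrite qmul_v4; congr v4;
  ring. Qed.

Lemma qnorm_mul a b : qnorm a = 1 -> qnorm b = 1 -> qnorm (qmul a b) = 1.
Proof.
have [a0 [a1 [a2 [a3 ->]]]] := v4P a; have [b0 [b1 [b2 [b3 ->]]]] := v4P b.
rewrite qmul_v4 => /qnorm1P na /qnorm1P nb; apply/qnorm1P.
transitivity ((a0 * a0 + a1 * a1 + a2 * a2 + a3 * a3) *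
  (b0 * b0 + b1 * b1 + b2 * b2 + b3 * b3)); first by ring.
by rewrite na nb mulr1.
Qed.

Lemma qinv_exists a : qnorm a = 1 -> exists b,
  [/\ qnorm b = 1, qmul a b = v4 1 0 0 0 & qmul b a = v4 1 0 0 0].
Proof.
have [a0 [a1 [a2 [a3 ->]]]] := v4P a => /qnorm1P na.
exists (v4 a0 (- a1) (- a2) (- a3)); split; first by apply/qnorm1P;
  rewrite -na; ring.
  by rewrite qmul_v4; congr v4; rewrite -?na; ring.
by rewrite qmul_v4; congr v4; rewrite -?na; ring.
Qed.

Definition qact a L : pg_subspace R := (linfun (qmul a) @: L)%VS.

Lemma qactM a b L : qact a (qact b L) = qact (qmul a b) L.
Proof.
rewrite /qact -limg_comp; congr (_ @: _)%VS.
by apply/lfunP => x; rewrite comp_lfunE !lfunE /= qmulA.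
Qed.

Lemma clifford_class_qact b L : qnorm b = 1 ->
  clifford_class (qact b L) = clifford_class L.
Proof.
move=> nb; have [c [nc _ cb]] := qinv_exists nb; apply/seteqP;
  split=> _ [a /= na <-].
  by exists (qmul a b); [exact: qnorm_mul|rewrite -/(qact _ _) -/(qact _ _)
    qactM].
exists (qmul a c); first exact: qnorm_mul.
by rewrite -/(qact _ _) -/(qact _ _) qactM -qmulA cb qmulq1.
Qed.

Lemma dim_qact a L : qnorm a = 1 -> \dim (qact a L) = \dim L.
Proof.
move=> na; have [c [_ _ ca]] := qinv_exists na.
apply: limg_dim_eq; apply/eqP; rewrite -subv0; apply/subvP => v.
rewrite memv_cap memv_ker => /andP[_]; rewrite lfunE /= => /eqP av0.
by rewrite -(qmul1q v) -ca -qmulA av0 linear0 mem0v.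
Qed.

(* Rotations preserve the dot and the cross product, hence they are
   automorphisms of the quaternions. *)
Lemma emb_qmul A a b : SO3 A -> emb A *m qmul a b =
  qmul (emb A *m a) (emb A *m b).
Proof.
have [a0 [a1 [a2 [a3 ->]]]] := v4P a; have [b0 [b1 [b2 [b3 ->]]]] := v4P b.
have [m1 [m2 [m3' [m4 [m5 [m6 [m7 [m8 [m9 ->]]]]]]]]] := m3P A.
move=> /SO3_m3[_ [c1 c2 c3] [c12 c13 c23] [[e1 e2 e3] [e4 e5 e6] [e7 e8 e9]]].
rewrite qmul_v4 !emb_v4 qmul_v4; congr v4.
- transitivity (a0 * b0 - (a1 * b1 * (m1 * m1 + m4 * m4 + m7 * m7) +
    a2 * b2 * (m2 * m2 + m5 * m5 + m8 * m8) + a3 * b3 * (m3' * m3' +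
      m6 * m6 + m9 * m9) +
    (a1 * b2 + a2 * b1) * (m1 * m2 + m4 * m5 + m7 * m8) +
    (a1 * b3 + a3 * b1) * (m1 * m3' + m4 * m6 + m7 * m9) +
    (a2 * b3 + a3 * b2) * (m2 * m3' + m5 * m6 + m8 * m9))); last by ring.
  by rewrite c1 c2 c3 c12 c13 c23; ring.
- transitivity (a0 * (m1 * b1 + m2 * b2 + m3' * b3) + b0 * (m1 * a1 +
  m2 * a2 + m3' * a3) +
    (m5 * m9 - m6 * m8) * (a2 * b3 - a3 * b2) +
      (m6 * m7 - m4 * m9) * (a3 * b1 - a1 * b3) +
    (m4 * m8 - m5 * m7) * (a1 * b2 - a2 * b1)); last by ring.
  by rewrite -e1 -e2 -e3; ring.
- transitivity (a0 * (m4 * b1 + m5 * b2 + m6 * b3) + b0 * (m4 * a1 +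
  m5 * a2 + m6 * a3) +
    (m8 * m3' - m9 * m2) * (a2 * b3 - a3 * b2) +
      (m9 * m1 - m7 * m3') * (a3 * b1 - a1 * b3) +
    (m7 * m2 - m8 * m1) * (a1 * b2 - a2 * b1)); last by ring.
  by rewrite -e4 -e5 -e6; ring.
- transitivity (a0 * (m7 * b1 + m8 * b2 + m9 * b3) + b0 * (m7 * a1 +
  m8 * a2 + m9 * a3) +
    (m2 * m6 - m3' * m5) * (a2 * b3 - a3 * b2) +
      (m3' * m4 - m1 * m6) * (a3 * b1 - a1 * b3) +
    (m1 * m5 - m2 * m4) * (a1 * b2 - a2 * b1)); last by ring.
  by rewrite -e7 -e8 -e9; ring.
Qed.

Lemma emb_qnorm A a : SO3 A -> qnorm a = 1 -> qnorm (emb A *m a) = 1.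
Proof.
have [a0 [a1 [a2 [a3 ->]]]] := v4P a.
have [m1 [m2 [m3' [m4 [m5 [m6 [m7 [m8 [m9 ->]]]]]]]]] := m3P A.
move=> /SO3_m3[_ [c1 c2 c3] [c12 c13 c23] _] /qnorm1P na.
rewrite emb_v4; apply/qnorm1P.
transitivity (a0 * a0 + (a1 * a1 * (m1 * m1 + m4 * m4 + m7 * m7) +
    a2 * a2 * (m2 * m2 + m5 * m5 + m8 * m8) + a3 * a3 * (m3' * m3' +
      m6 * m6 + m9 * m9) +
    (a1 * a2 + a2 * a1) * (m1 * m2 + m4 * m5 + m7 * m8) +
    (a1 * a3 + a3 * a1) * (m1 * m3' + m4 * m6 + m7 * m9) +
    (a2 * a3 + a3 * a2) * (m2 * m3' + m5 * m6 + m8 * m9))); first by ring.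
by rewrite c1 c2 c3 c12 c13 c23 -[RHS]na; ring.
Qed.

(** As an automorphism, A maps aL to (Aa)(AL), and it permutes the unit quaternions. *)
Lemma emb_clifford_class A L : SO3 A ->
  mx_act (emb A) @` clifford_class L = clifford_class (mx_act (emb A) L).
Proof.
move=> sA.
have E a : mx_act (emb A) (qact a L) = qact (emb A *m a) (mx_act (emb A) L).
  rewrite /mx_act /qact -!limg_comp; congr (_ @: _)%VS.
  by apply/lfunP => x; rewrite !comp_lfunE !lfunE /= emb_qmul.
apply/seteqP; split=> [_ [_ [a /= na <-] <-]|_ [a /= na <-]].
  by exists (emb A *m a); [exact: emb_qnorm|rewrite -/(qact _ _) -E].
have sA' := SO3_tr sA.
exists (qact (emb A^T *m a) L); first by exists (emb A^T *m a) => //;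
  exact: emb_qnorm.
by rewrite E mulmxA -embM; case: sA => -> _; rewrite emb1 mul1mx.
Qed.

(** Left multiplication by the inverse of a unit quaternion in L stays in the class and yields a
    line <1, z> with z a pure unit; some rotation takes i to z. *)
Lemma line_clifford_class L : pg_lines L ->
  exists2 A, SO3 A & clifford_class L = clifford_class (mx_act (emb A) C0).
Proof.
move=> L2; have [x' x'0 x'L] := line_neq0 L2.
have [k k0 nx] := qnorm_normalize x'0; set x := k *: x' in nx.
have xL : x \in L by apply: memvZ.
have [c [nc xc cx]] := qinv_exists nx.
rewrite -(clifford_class_qact L nc); set L' := qact c L.
have L'2 : pg_lines L' by rewrite /pg_lines /= dim_qact.
have eL : v4 1 0 0 0 \in L'.
  by rewrite -cx; apply/memv_imgP; exists x => //; rewrite lfunE.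
have e0 : @v4 R 1 0 0 0 != 0 by apply: v4_neq0; rewrite oner_eq0.
have [y ind LE] := line_basis L'2 e0 eL.
have [y0 [y1 [y2 [y3 yE]]]] := v4P y; rewrite {}yE in ind LE.
have yL : v4 0 y1 y2 y3 \in L'.
  have yL' : v4 y0 y1 y2 y3 \in L' by rewrite LE mem_pliner.
  have := memvD yL' (memvZ (- y0) eL); rewrite v4Z v4D.
  by move/mem_v4_eq; apply; ring.
have z0 : v4 0 y1 y2 y3 != 0.
  apply/eqP => /v4_eq0[_ y10 y20 y30]; have [] := ind y0 (-1).
    by rewrite !v4Z v4D y10 y20 y30 -v4_0; congr v4; ring.
  by move=> _ /eqP; rewrite oppr_eq0 oner_eq0.
have [l l0] := qnorm_normalize z0; rewrite v4Z mulr0 => /qnorm1P;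
  rewrite mulr0 add0r => nl.
have [p [q /=]] := SO3_transitive nl.
set P := rotx p *m rotz q => -[P0 P1 P2].
have sP : SO3 P := SO3_mul (SO3_rotx p) (SO3_rotz q).
exists P => //; congr clifford_class.
rewrite mx_act_pline (m3E P) !emb_v4 P0 P1 P2.
apply: pline_eq => //.
- by move: eL => /mem_v4_eq; apply; ring.
- by move: (memvZ l yL); rewrite v4Z => /mem_v4_eq; apply; ring.
move=> a b; rewrite !v4Z v4D => /v4_eq0[e0' e1' e2' e3'].
have {}e0' : a = 0 by lra.
split=> //; rewrite -[LHS]mulr1 -nl.
transitivity (l * y1 * (b * (l * y1)) + l * y2 * (b * (l * y2)) +
  l * y3 * (b * (l * y3))).
  by ring.
rewrite e0' in e1' e2' e3'.
have -> : b * (l * y1) = 0 by lra.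
have -> : b * (l * y2) = 0 by lra.
have -> : b * (l * y3) = 0 by lra.
by rewrite !mulr0 !addr0.
Qed.

End Quaternions.

(** * The subgroup O(2) *)

Section O2.
Variable R : realType.
Local Notation SO3 := (@special_orthogonal_group R 3).
Local Notation O2 := (@orthogonal_group R 2).
Local Notation C0 := (@hopf_line R 0 0).
Implicit Types (P : 'M[R]_3) (T : 'M[R]_4).

Definition m2 (a b c d : R) : 'M[R]_2 :=
  \matrix_(j, k) (nth [::] [:: [:: a; b]; [:: c; d]] j)`_k.

Lemma m2_mul a b c d a' b' c' d' : m2 a b c d *m m2 a' b' c' d' =
  m2 (a * a' + b * c') (a * b' + b * d') (c * a' + d * c') (c * b' + d * d').
Proof.
by apply/matrixP => -[[|[|//]] ?] [[|[|//]] ?];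
  rewrite !mxE !big_ord_recl big_ord0 !mxE /= addr0.
Qed.

Lemma m2_tr a b c d : (m2 a b c d)^T = m2 a c b d.
Proof. by apply/matrixP => -[[|[|//]] ?] [[|[|//]] ?]; rewrite !mxE. Qed.

Lemma m2_1 : 1%:M = m2 1 0 0 1.
Proof. by apply/matrixP => -[[|[|//]] ?] [[|[|//]] ?]; rewrite !mxE. Qed.

Definition rot2 (t : R) := m2 (cos t) (- sin t) (sin t) (cos t).
Definition refl2 := m2 1 0 0 (-1).

Lemma O2_rot2 t : O2 (rot2 t).
Proof.
rewrite /orthogonal_group /= m2_tr m2_mul m2_1; have := cos2Dsin2 t.
by rewrite !expr2 => cs; congr m2; lra.
Qed.

Lemma O2_refl2 : O2 refl2.
Proof. by rewrite /orthogonal_group /= m2_tr m2_mul m2_1; congr m2; ring. Qed.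

Lemma rot2D s t : rot2 (s + t) = rot2 s *m rot2 t.
Proof. by rewrite /rot2 cosD sinD m2_mul; congr m2; ring. Qed.

Lemma refl2_rot2 t : refl2 *m rot2 t = rot2 (- t) *m refl2.
Proof. by rewrite /rot2 cosN sinN !m2_mul; congr m2; ring. Qed.

Lemma rot2_pi_neq : rot2 pi <> rot2 (pi + pi).
Proof.
rewrite rot2D {2 3}/rot2 /rot2 sinpi cospi m2_mul => /matrixP/(_ ord0 ord0).
by rewrite !mxE /=; lra.
Qed.

Lemma mxcont_rot2 : mxcont rot2.
Proof.
move=> -[[|[|//]] ?] [[|[|//]] ?] t; rewrite /rot2;
  under [X in continuous_at _ X]eq_fun do rewrite mxE /=;
    rewrite /continuous_at /=;
  do ?[exact: cvg_cst|exact: continuous_cos|exact: continuous_sin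
      |apply: cvgN; exact: continuous_sin].
Qed.

(** [circle_normal_form] is applied to the rotations of O(2) and a reflection inverting them. The
    image of the reflection reverses the axis, so it differs from [roty pi] by a rotation about that
    axis, which also comes from O(2). *)
Lemma O2_normal_form T (Delta : set 'M[R]_4) : T \in unitmx ->
  (forall M, Delta M -> exists2 A, SO3 A & T *m M = emb A *m T) ->
  mx_group Delta -> top_group_iso Delta O2 ->
  exists2 P, SO3 P &
    (forall s, exists2 M, Delta M & (emb P^T *m T) *m M =
      emb (rotx s) *m (emb P^T *m T)) /\
    exists2 M, Delta M & (emb P^T *m T) *m M = emb (roty pi) *m (emb P^T *m T).
Proof.
move=> Tu TD gD [f [g [[fO fi fs] gf fM _ cg]]]; have [_ _ DM _] := gD.
have gS A : O2 A -> Delta (g A) /\ f (g A) = A.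
  by move=> /fs[M DM' <-]; rewrite gf.
have gM A B : O2 A -> O2 B -> g (A *m B) = g A *m g B.
  by move=> /gS[OA fA] /gS[OB fB]; rewrite -{1}fA -{1}fB -fM// gf//; apply: DM.
pose rho A := linpart T (g A).
have rhoES A : O2 A -> SO3 (rho A) /\ T *m g A = emb (rho A) *m T.
  by move=> /gS[/TD[G G1 GE] _]; rewrite /rho (linpartE Tu GE).
have rhoS A : O2 A -> SO3 (rho A) by move=> /rhoES[].
have rhoE A : O2 A -> T *m g A = emb (rho A) *m T by move=> /rhoES[].
have rhoM A B : O2 A -> O2 B -> rho (A *m B) = rho A *m rho B.
  move=> oA oB; rewrite /rho gM//; apply: linpartE => //.
  by rewrite mulmxA rhoE// -mulmxA rhoE// mulmxA -embM.
have orot := O2_rot2; have orefl := O2_refl2.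
have rot2_2pi : rot2 (pi + pi) = 1%:M.
  by rewrite rot2D /rot2 sinpi cospi m2_mul m2_1; congr m2; ring.
have rho2pi : rho (rot2 (pi + pi)) = 1%:M.
  by apply: SO3_idem; [exact: rhoS|rewrite -rhoM// rot2_2pi mul1mx].
have [|||||||P [sP Ponto PE]] := circle_normal_form (h :=
  rho \o rot2) (E := rho refl2).
- by move=> t; apply: rhoS.
- by move=> s t /=; rewrite rot2D rhoM.
- have cG := mxcont_within cg mxcont_rot2 orot.
  exact: (@mxcont_linpart R T _ cG).
- exact: rho2pi.
- move=> /= rpi; apply: rot2_pi_neq.
  rewrite -(proj2 (gS _ (orot pi))) -[RHS](proj2 (gS _ (orot _))); congr f.
  by apply: (can_inj (mulKmx Tu)); rewrite !rhoE// rpi rho2pi.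
- exact: rhoS.
- by move=> t /=; rewrite -!rhoM// refl2_rot2.
have PP : P *m P^T = 1%:M by case: sP.
have conjE M B : T *m M = emb B *m T ->
    (emb P^T *m T) *m M = emb (P^T *m B *m P) *m (emb P^T *m T).
  move=> TM; rewrite -mulmxA TM !mulmxA -!embM -(mulmxA _ P) PP mulmx1.
  by [].
exists P => //; split=> [s|].
  have [t tE] := Ponto s; exists (g (rot2 t)); first by case: (gS _ (orot t)).
  by rewrite -tE; apply/conjE/rhoE.
set F := P^T *m _ *m P in PE.
have sF : SO3 F := SO3_conj (rhoS _ orefl) sP.
have sy := @SO3_roty R pi.
(* Both factors reverse the first axis, so their product fixes it. *)
have [|s _ sE] := rotx_exists (SO3_mul sy sF).
  rewrite mxE (bigD1 ord0)//= big1 ?addr0 => [|i i0].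
    by rewrite PE roty_pi mxE /= mulrNN mulr1.
  by rewrite roty_pi mxE; case: (ord3_cases i) i0 => -> //=; rewrite mul0r.
have [t tE] := Ponto (- s).
exists (g (refl2 *m rot2 t)).
  by rewrite gM//; apply: DM; [case: (gS _ orefl)|case: (gS _ (orot t))].
have -> : roty pi = P^T *m rho (refl2 *m rot2 t) *m P.
  rewrite rhoM// -SO3_conjM// -/F tE rotxN.
  by rewrite -sE trmx_mul mulmxA; case: sF => -> _;
    rewrite mul1mx roty_pi m3_tr.
apply/conjE/rhoE; rewrite /orthogonal_group /= trmx_mul mulmxA -(mulmxA refl2).
by rewrite (orot t) mulmx1; exact: orefl.
Qed.

End O2.

Theorem theorem5p6 (R : realType) (C : set (pg_subspace R))
    (Omega : set 'M[R]_4) :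
  complex_spread C ->
  mx_group Omega ->
  Omega `<=` @affine_group3 R ->
  top_group_iso Omega (@special_orthogonal_group R 3) ->
  O2_admissible Omega C ->
  parallelism_iso (spread_orbit Omega C) (@clifford_parallelism R).
Proof.
move=> /complex_spread_regular rC gO Oaff isoO [Delta [DO gD isoD DC]].
have [T Tu [TO OT]] := affine_SO3_normal_form gO Oaff isoO.
have TD M : Delta M -> exists2 A : 'M[R]_3,
  special_orthogonal_group A & T *m M = emb A *m T.
  by move=> /DO /TO.
have [P sP [Px [My DMy Py]]] := O2_normal_form Tu TD gD isoD.
set U := emb P^T *m T in Px Py.
have Uu : U \in unitmx by rewrite unitmx_mul Tu emb_unit ?SO3_unit//;
  exact: SO3_tr.
have inv M N : Delta M -> U *m M = N *m U ->
    forall L, (mx_act U @` C) L -> (mx_act U @` C) (mx_act N L).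
  move=> DM UM _ [L CL <-]; exists (mx_act M L); last by rewrite -!mx_actM UM.
  by rewrite -(DC M DM); exists L.
have [|s||l l0 lE] := @rotation_invariant_spread_clifford R (mx_act U @` C).
- exact: collineation_regular (mx_act_collineation Uu) rC.
- by have [M DM UM] := Px s; apply: inv DM UM.
- exact: inv DMy Py.
have [PP _] := sP.
(* The collineation [scale0 l *m U] serves all w at once: U turns w into a rotation, and [scale0 l]
   commutes with rotations. *)
have orbit w (A : 'M[R]_3) : special_orthogonal_group A ->
  T *m w = emb A *m T ->
    mx_act (scale0 l *m U) @` (mx_act w @` C) =
    clifford_class (mx_act (emb (P^T *m A *m P)) (hopf_line 0 0)).
  move=> sA Tw; rewrite -emb_clifford_class; last exact: SO3_conj.
  have Uw : U *m w = emb (P^T *m A *m P) *m U.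
    by rewrite /U -mulmxA Tw !mulmxA -!embM -(mulmxA _ P) PP mulmx1.
  rewrite -lE !image_comp; apply: eq_imagel => L _ /=.
  rewrite -!mx_actM; congr mx_act.
  by rewrite -mulmxA Uw !mulmxA scale0_emb.
exists (mx_act (scale0 l *m U)).
  by apply: mx_act_collineation; rewrite unitmx_mul scale0_unit.
apply/seteqP; split=> [_ [_ [w Ow <-] <-]|_ [L lL <-]].
  have [A sA Tw] := TO w Ow; rewrite (orbit w A sA Tw).
  eexists; last reflexivity.
  rewrite /pg_lines /= dim_mx_act; first exact/dim_pline/indep2_hopf.
  exact/emb_unit/SO3_unit/SO3_conj.
have [A sA ->] := line_clifford_class lL.
(* Conjugating back by P compensates for the change of axis contained in U. *)
have sA' : special_orthogonal_group (P *m A *m P^T).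
  exact: SO3_mul (SO3_mul sP sA) (SO3_tr sP).
have [w Ow Tw] := OT _ sA'.
exists (mx_act w @` C); first by exists w.
rewrite (orbit w _ sA' Tw); congr (clifford_class (mx_act (emb _) _)).
by rewrite !mulmxA SO3_trl// mul1mx -mulmxA SO3_trl// mulmx1.
Qed.
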